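(* Let $K\subseteq\mathbb{R}^2$ be a self-similar $1$-set. Assume that there are three different lines through the origin such that the orthogonal projection of $K$ onto each of them is an interval of length $c$ centered at the origin. Then for $\mu=\mathcal{H}^1|_K$ we have $\int xy\,\mathrm{d}\mu(x,y)=0$ and $$\int |P_\gamma(x,y)|^2\,\mathrm{d}\mu(x,y)=\mathcal{H}^1(K)\cdot\frac{c^2}{12}\quad\text{for every }\gamma\in\mathbb{R}.$$ Furthermore, if $P_\theta(K)$ is an interval for some $\theta\in\mathbb{R}$, then $P_\theta(K)$ is an interval of length $c$ centered at the origin.
   Context: A self-similar set in $\mathbb{R}^2$ is the attractor of a finite collection $\{S_i\}_{i=1}^m$ of contracting similarities $S_i:\mathbb{R}^2\to\mathbb{R}^2$, i.e. the unique nonempty compact set $K$ with $K=\bigcup_{i=1}^m S_i(K)$ (no separation condition is assumed). $K$ is a $1$-set if $0<\mathcal{H}^1(K)<\infty$, where $\mathcal{H}^1$ is $1$-dimensional Hausdorff measure; $\mathcal{H}^1|_K$ is its restriction to $K$. For $\theta\in\mathbb{R}$, $L_\theta=\{(t\cos\theta,t\sin\theta):t\in\mathbb{R}\}$ and $P_\theta:\mathbb{R}^2\to L_\theta$ is the orthogonal projection onto $L_\theta$; $L_\theta$ is identified with $\mathbb{R}$ via the parameter $t$, so that $|P_\theta(x,y)|=|x\cos\theta+y\sin\theta|$. A single point counts as a closed interval of length $0$. *)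

(* Defs.v *)
From HB Require Import structures.
From mathcomp Require Import all_boot all_order all_algebra.
From mathcomp Require Import all_classical all_reals all_analysis.
From mathcomp Require Import ring lra zify.

Set Implicit Arguments.
Unset Strict Implicit.
Unset Printing Implicit Defensive.

Import Order.TTheory GRing.Theory Num.Theory.
Import numFieldNormedType.Exports.

Local Open Scope classical_set_scope.
Local Open Scope ring_scope.
Local Open Scope ereal_scope.

(* The plane is [R * R]; its library topology and Borel sigma-algebra (the
   product ones) are the usual ones, but its library norm is the sup norm,
   hence the explicit Euclidean distance. *)
Definition eucl_dist (R : realType) (x y : R * R) : R :=
  Num.sqrt ((x.1 - y.1) ^+ 2 + (x.2 - y.2) ^+ 2).

(* The maximum with 0 gives [eucl_diam set0 = 0] instead of [-oo]. *)
Definition eucl_diam (R : realType) (A : set (R * R)) : \bar R :=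
  maxe 0 (ereal_sup [set (eucl_dist p.1 p.2)%:E | p in A `*` A]).

Definition hausdorff1_pre (R : realType) (delta : R) (A : set (R * R)) :
    \bar R :=
  ereal_inf [set \sum_(k <oo) eucl_diam (U k) | U in
    [set U : (set (R * R))^nat |
      (forall k, eucl_diam (U k) <= delta%:E) /\ A `<=` \bigcup_k U k]].

Definition hausdorff1 (R : realType) (A : set (R * R)) : \bar R :=
  ereal_sup [set hausdorff1_pre delta A | delta in [set delta | (0 < delta)%R]].

Section eucl_diam.
Context (R : realType).
Implicit Types (x y : R * R) (A B : set (R * R)).

Lemma eucl_dist_ge0 x y : (0 <= eucl_dist x y)%R.
Proof. exact: sqrtr_ge0. Qed.

Lemma eucl_dist_fst x y : (`|x.1 - y.1| <= eucl_dist x y)%R.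
Proof. by rewrite -sqrtr_sqr ler_wsqrtr// lerDl sqr_ge0. Qed.

Lemma eucl_dist_snd x y : (`|x.2 - y.2| <= eucl_dist x y)%R.
Proof. by rewrite -sqrtr_sqr ler_wsqrtr// lerDr sqr_ge0. Qed.

Lemma eucl_diam0 : eucl_diam (@set0 (R * R)) = 0.
Proof. by rewrite /eucl_diam setX0 image_set0 ereal_sup0 maxeNy. Qed.

Lemma eucl_diam_ge0 A : 0 <= eucl_diam A.
Proof. by rewrite le_max lexx. Qed.

Lemma le_eucl_diam A B : A `<=` B -> eucl_diam A <= eucl_diam B.
Proof.
move=> AB; rewrite /eucl_diam ge_max le_max lexx /= le_max; apply/orP; right.
by apply: ereal_sup_le => _ [p [A1 A2] <-]; exists p => //; split; exact: AB.
Qed.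

Lemma eucl_dist_le_diam A x y : A x -> A y -> (eucl_dist x y)%:E <= eucl_diam A.
Proof.
by move=> Ax Ay; rewrite le_max; apply/orP; right; apply: ereal_sup_ubound;
  exists (x, y).
Qed.

End eucl_diam.

Section hausdorff1_outer.
Context (R : realType).
Implicit Types (delta : R) (A B X : set (R * R)).

Lemma hausdorff1_pre_ge0 delta A : 0 <= hausdorff1_pre delta A.
Proof.
by apply: le_ereal_inf_tmp => _ [U _ <-]; apply: nneseries_ge0 => *;
  exact: eucl_diam_ge0.
Qed.

Lemma hausdorff1_pre_le delta (U : (set (R * R))^nat) A :
  (forall k, eucl_diam (U k) <= delta%:E) -> A `<=` \bigcup_k U k ->
  hausdorff1_pre delta A <= \sum_(k <oo) eucl_diam (U k).
Proof. by move=> Ud AU; apply: ereal_inf_lbound; exists U. Qed.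

Lemma le_hausdorff1_pre delta delta' A B : (delta' <= delta)%R -> A `<=` B ->
  hausdorff1_pre delta A <= hausdorff1_pre delta' B.
Proof.
move=> dd AB; apply: ereal_inf_le_tmp => _ [U [Ud BU] <-]; exists U => //.
split; last exact: subset_trans BU.
by move=> k; rewrite (le_trans (Ud k))// lee_fin.
Qed.

Lemma hausdorff1_pre_subadditive delta :
  sigma_subadditive (@hausdorff1_pre R delta).
Proof.
set mu := hausdorff1_pre delta.
move=> A; have [[i ioo]|] := pselect (exists i, mu (A i) = +oo).
  rewrite (eseries_pinfty _ _ ioo) ?leey// => n _.
  by rewrite -ltNye (lt_le_trans _ (hausdorff1_pre_ge0 _ _)).
rewrite -forallNE => Aoo.
suff add2e (e : {posnum R}) :
    mu (\bigcup_n A n) <= \sum_(i <oo) mu (A i) + e%:num%:E.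
  by apply/lee_addgt0Pr => _/posnumP[].
rewrite (le_trans _ (epsilon_trick _ _ _))//; last first.
  by move=> n; exact: hausdorff1_pre_ge0.
pose P n (B : (set (R * R))^nat) :=
  ((forall k, eucl_diam (B k) <= delta%:E) /\ A n `<=` \bigcup_k B k) /\
  \sum_(k <oo) eucl_diam (B k) <= mu (A n) + (e%:num / (2 ^ n.+1)%:R)%:E.
have [G PG] : {G : ((set (R * R))^nat)^nat & forall n, P n (G n)}.
  apply: (@choice _ _ P) => n; rewrite /P /mu /hausdorff1_pre.
  set S := (X in ereal_inf X); move infS : (ereal_inf S) => iS.
  case: iS infS => [r Sr|Soo|Soo].
  - have en1 : (0 < e%:num / (2 ^ n.+1)%:R)%R by [].
    have /(lb_ereal_inf_adherent en1) : ereal_inf S \is a fin_num by rewrite Sr.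
    move=> [x [B [mB AnB muBx] xS]].
    by exists B; split => //; rewrite muBx -Sr; exact/ltW.
  - by have := Aoo n; rewrite /mu /hausdorff1_pre -/S Soo.
  - by have := hausdorff1_pre_ge0 delta (A n); rewrite /hausdorff1_pre -/S Soo.
have diamG_ge0 x : 0 <= (@eucl_diam R \o uncurry G) x by exact: eucl_diam_ge0.
apply: (@le_trans _ _ (\esum_(i in setT) (@eucl_diam R \o uncurry G) i)).
  have /card_esym/ppcard_eqP[f] := card_nat2.
  rewrite /mu /hausdorff1_pre; apply: ereal_inf_lbound => /=.
  exists (uncurry G \o f).
    split => [i|].
      by rewrite /= /uncurry; case: (f i) => a b; exact: (PG a).1.1.
    apply: (@subset_trans _  (\bigcup_n \bigcup_k G n k)) => [t [i _]|].
      by move=> /((PG i).1.2) -[j _ ?]; exists i => //; exists j.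
    move=> t [i _ [j _ Bijt]]; exists (f^-1%FUN (i, j)) => //=.
    by rewrite invK ?inE.
  rewrite -(esum_pred_image (@eucl_diam R \o uncurry G) _ xpredT)
    ?[fun=> _]set_true//.
  by rewrite image_eq.
rewrite (_ : esum _ _ = \sum_(i <oo) \sum_(j <oo) eucl_diam (G i j));
  last first.
  pose J : nat -> set (nat * nat) := fun i => [set (i, j) | j in setT].
  rewrite (_ : setT = \bigcup_k J k); last first.
    by rewrite predeqE => -[a b]; split => // _; exists a => //; exists b.
  rewrite esum_bigcupT /=; last 2 first.
    - apply/trivIsetP => i j _ _ ij.
      rewrite predeqE => -[n m] /=; split => //= -[] [_] _ [<-{n} _].
      by move=> [m' _] [] /esym/eqP; rewrite (negbTE ij).
    - by move=> /= [n m]; exact: eucl_diam_ge0.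
  rewrite -(image_id [set: nat]) -fun_true esum_pred_image//; last first.
    by move=> n _; apply: esum_ge0 => *; exact: eucl_diam_ge0.
  apply: eq_eseriesr => /= j _.
  rewrite -(esum_pred_image (@eucl_diam R \o uncurry G) (pair j) predT)/=;
    last 2 first.
    - by move=> *; exact: eucl_diam_ge0.
    - by move=> ? ? _ _; exact: (@can_inj _ _ _ snd).
  by congr esum; rewrite predeqE => -[a b]; split; move=> [i _ <-]; exists i.
apply: lee_nneseries => [i _ _|i _].
  by apply: nneseries_ge0 => *; exact: eucl_diam_ge0.
exact: (PG i).2.
Qed.

Lemma hausdorff1_pre_le_hausdorff1 delta A : (0 < delta)%R ->
  hausdorff1_pre delta A <= hausdorff1 A.
Proof. by move=> d0; apply: ereal_sup_ubound; exists delta. Qed.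

Lemma hausdorff1_ge0 A : 0 <= hausdorff1 A.
Proof.
exact: le_trans (hausdorff1_pre_ge0 1 A) (hausdorff1_pre_le_hausdorff1 A ltr01).
Qed.

Lemma hausdorff1_set0 : hausdorff1 (@set0 (R * R)) = 0.
Proof.
apply/eqP; rewrite eq_le hausdorff1_ge0 andbT.
apply: ge_ereal_sup => _ [d d0 <-].
apply: le_trans (@hausdorff1_pre_le d (fun=> set0) _ _ _) _ => //.
  by move=> k; rewrite eucl_diam0 lee_fin ltW.
by rewrite eseries0// => *; rewrite eucl_diam0.
Qed.

Lemma le_hausdorff1 : {homo @hausdorff1 R : A B / A `<=` B >-> A <= B}.
Proof.
move=> A B AB; apply: ge_ereal_sup => _ [d d0 <-].
apply: le_trans (hausdorff1_pre_le_hausdorff1 _ d0).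
exact: le_hausdorff1_pre.
Qed.

Lemma hausdorff1_sigma_subadditive : sigma_subadditive (@hausdorff1 R).
Proof.
move=> F; apply: ge_ereal_sup => _ [d d0 <-].
apply: le_trans (@hausdorff1_pre_subadditive d F) _.
apply: lee_nneseries => *; first exact: hausdorff1_pre_ge0.
exact: hausdorff1_pre_le_hausdorff1.
Qed.

HB.instance Definition _ := isOuterMeasure.Build R (R * R)%type (@hausdorff1 R)
  hausdorff1_set0 hausdorff1_ge0 le_hausdorff1 hausdorff1_sigma_subadditive.

Lemma hausdorff1_separated (e : R) A B : (0 < e)%R ->
  (forall x y, A x -> B y -> (e <= eucl_dist x y)%R) ->
  hausdorff1 A + hausdorff1 B <= hausdorff1 (A `|` B).
Proof.
move=> e0 sepAB.
have preAB d : (0 < d)%R -> (d < e)%R -> hausdorff1_pre d A + hausdorff1_pre d B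
    <= hausdorff1_pre d (A `|` B).
  move=> d0 de; apply: le_ereal_inf_tmp => _ [U [Ud ABU] <-].
  pose UA k := U k `&` A; pose UB k := U k `&` B.
  apply: (@le_trans _ _
    (\sum_(k <oo) eucl_diam (UA k) + \sum_(k <oo) eucl_diam (UB k))).
    apply: leeD; apply: hausdorff1_pre_le.
    - by move=> k; rewrite (le_trans _ (Ud k))//; apply: le_eucl_diam => ? [].
    - move=> z Az; have [k _ Uz] := ABU z (or_introl Az).
      by exists k => //; split.
    - by move=> k; rewrite (le_trans _ (Ud k))//; apply: le_eucl_diam => ? [].
    - move=> z Bz; have [k _ Uz] := ABU z (or_intror Bz).
      by exists k => //; split.
  rewrite -nneseriesD; [|by move=> *; exact: eucl_diam_ge0..].
  apply: lee_nneseries => [k _ _|k _].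
    by apply: adde_ge0; exact: eucl_diam_ge0.
  have [[x [Ux Ax]]|/forallNP UA0] := pselect (exists x, UA k x).
    have -> : UB k = set0.
      apply/seteqP; split => // y [Uy By].
      have := le_trans (eucl_dist_le_diam Ux Uy) (Ud k).
      by rewrite lee_fin leNgt (lt_le_trans de)//; exact: sepAB.
    by rewrite eucl_diam0 adde0; apply: le_eucl_diam => ? [].
  have -> : UA k = set0 by apply/seteqP; split => // y /UA0.
  by rewrite eucl_diam0 add0e; apply: le_eucl_diam => ? [].
have pre2 d1 d2 : (0 < d1)%R -> (0 < d2)%R ->
    hausdorff1_pre d1 A + hausdorff1_pre d2 B <= hausdorff1 (A `|` B).
  move=> d10 d20; pose d := Num.min (Num.min d1 d2) (e / 2)%R.
  have d0 : (0 < d)%R by rewrite !lt_min d10 d20 divr_gt0.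
  have de : (d < e)%R by rewrite gt_min; apply/orP; right; lra.
  apply: le_trans (hausdorff1_pre_le_hausdorff1 _ d0).
  apply: le_trans (preAB _ d0 de); apply: leeD; apply: le_hausdorff1_pre => //.
    by rewrite !ge_min lexx.
  by rewrite !ge_min lexx orbT.
have [->|ABoo] := eqVneq (hausdorff1 (A `|` B)) +oo; first exact: leey.
have ABfin : hausdorff1 (A `|` B) \is a fin_num.
  by rewrite ge0_fin_numE ?hausdorff1_ge0// ltey.
have finS C : C `<=` A `|` B -> hausdorff1 C \is a fin_num.
  move=> CAB; rewrite ge0_fin_numE ?hausdorff1_ge0//.
  by apply: le_lt_trans (le_hausdorff1 CAB) _; rewrite ltey.
have Bfin : hausdorff1 B \is a fin_num by apply: finS; exact: subsetUr.
rewrite -leeBrDr//; apply: ge_ereal_sup => _ [d1 d10 <-].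
have Afin : hausdorff1_pre d1 A \is a fin_num.
  rewrite ge0_fin_numE ?hausdorff1_pre_ge0//.
  apply: le_lt_trans (hausdorff1_pre_le_hausdorff1 A d10) _.
  by rewrite -ge0_fin_numE ?hausdorff1_ge0//; apply: finS; exact: subsetUl.
rewrite leeBrDr// addeC -leeBrDr//; apply: ge_ereal_sup => _ [d2 d20 <-].
by rewrite leeBrDr// addeC; exact: pre2.
Qed.

End hausdorff1_outer.

Section hausdorff1_borel.
Context (R : realType).
Implicit Types (f : R * R -> R) (A X : set (R * R)).

Let H := @hausdorff1 R.

Section lipschitz.
Variables (f : R * R -> R) (X : set (R * R)).
Hypothesis f_lip : forall x y, (`|f x - f y| <= eucl_dist x y)%R.
Hypothesis HXoo : H X < +oo.

Let t (k : nat) : R := (k.+1%:R)^-1.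
Let S k := X `&` [set z | (t k < f z)%R].
Let annulus k := X `&` [set z | (t k.+2 < f z <= t k.+1)%R].

Let t_gt0 k : (0 < t k)%R. Proof. by rewrite invr_gt0 ltr0n. Qed.

Let t_dec k l : (k < l)%N -> (t l < t k)%R.
Proof. by move=> kl; rewrite ltf_pV2 ?posrE ?ltr0n// ltr_nat. Qed.

Let t_le k l : (k <= l)%N -> (t l <= t k)%R.
Proof. by move=> kl; rewrite lef_pV2 ?posrE ?ltr0n// ler_nat. Qed.

Let separated (a b : R) A B : (a < b)%R -> (forall z, A z -> (b <= f z)%R) ->
  (forall z, B z -> (f z <= a)%R) -> H A + H B <= H (A `|` B).
Proof.
move=> ab Af Bf; apply: (@hausdorff1_separated _ (b - a)%R).
  by rewrite subr_gt0.
move=> x y /Af bx /Bf ya; apply: le_trans (f_lip x y).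
by apply: le_trans (ler_norm _); lra.
Qed.

Let sum_annulus b N :
  \sum_(k < N) H (annulus (k.*2 + b)%N) <= H (S (N.*2 + b)%N).
Proof.
elim: N => [|N IH]; first by rewrite big_ord0 hausdorff1_ge0.
rewrite big_ord_recr/=.
apply: le_trans (leeD IH (lexx _)) _.
apply: (@le_trans _ _ (H (S (N.*2 + b)%N `|` annulus (N.*2 + b)%N))).
  apply: (@separated (t (N.*2 + b).+1) (t (N.*2 + b))); first exact: t_dec.
    by move=> z [_ /ltW].
  by move=> z [_ /andP[]].
apply: le_hausdorff1 => z [[Xz /= tz]|[Xz /andP[tz _]]]; split => //=.
by apply: le_lt_trans tz; apply: t_le; lia.
Qed.

Let sum_annulus_le : \sum_(k <oo) H (annulus k) <= H X + H X.
Proof.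
have half b N : \sum_(k < N) H (annulus (k.*2 + b)%N) <= H X.
  by apply: le_trans (sum_annulus b N) _; apply: le_hausdorff1 => z [].
have fin N : \sum_(k < N.*2) H (annulus k) <= H X + H X.
  suff -> : \sum_(k < N.*2) H (annulus k) =
      \sum_(k < N) H (annulus (k.*2 + 0)%N) +
      \sum_(k < N) H (annulus (k.*2 + 1)%N) by exact: leeD.
  rewrite -big_split/=; elim: N => [|N IH]; first by rewrite !big_ord0.
  by rewrite doubleS !big_ord_recr/= IH -addeA addn0 addn1.
apply: lime_le.
  by apply: is_cvg_nneseries => *; exact: hausdorff1_ge0.
apply: nearW => N; rewrite big_mkord; apply: le_trans (fin N).
rewrite -!(big_mkord xpredT (fun k => H (annulus k))).
apply: lee_sum_nneg_natr => [k *|]; first exact: hausdorff1_ge0.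
by lia.
Qed.

Let cover n : X `&` [set z | (0 < f z)%R] `<=`
  S n.+1 `|` \bigcup_(k in ~` `I_n) annulus k.
Proof.
move=> z [Xz /= fz].
have [fn|fn] := ltP (t n.+1) (f z); first by left; split.
right.
have exm : exists m, (t m < f z)%R.
  have [m _ /(_ m (leqnn _)) mfz] := near_infty_natSinv_lt (PosNum fz).
  by exists m.
case: (ex_minnP exm) => m mz mmin.
have nm : (n.+1 < m)%N.
  rewrite ltnNge; apply/negP => mn; move: fn; rewrite leNgt => /negP; apply.
  by apply: le_lt_trans mz; exact: t_le.
case: m => [|[|m]] // in mz mmin nm *.
exists m; first by rewrite /=; apply/negP; rewrite -leqNgt; lia.
split => //=; rewrite mz leNgt /=; apply/negP => /mmin.
by rewrite ltnn.
Qed.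

Lemma hausdorff1_lipschitz_split :
  H (X `&` [set z | (0 < f z)%R]) + H (X `&` ~` [set z | (0 < f z)%R]) <= H X.
Proof.
have HXfin : H X \is a fin_num by rewrite ge0_fin_numE// hausdorff1_ge0.
have sum_fin : \sum_(k <oo) H (annulus k) < +oo.
  by apply: le_lt_trans sum_annulus_le _; rewrite lte_add_pinfty.
have tail0 : \sum_(N <= k <oo) H (annulus k) @[N --> \oo] --> 0.
  by apply: nneseries_tail_cvg => // *; exact: hausdorff1_ge0.
set B := X `&` ~` _.
have SB n : H (S n) + H B <= H X.
  apply: (@le_trans _ _ (H (S n `|` B))).
    apply: (@separated 0%R (t n)); first exact: t_gt0.
      by move=> z [_ /ltW].
    by move=> z [_ /negP]; rewrite -leNgt.
  by apply: le_hausdorff1 => z [[]|[]].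
have bound n : H (X `&` [set z | (0 < f z)%R]) + H B <=
    H X + \sum_(n <= k <oo) H (annulus k).
  apply: le_trans (leeD (le_hausdorff1 (@cover n)) (lexx _)) _.
  have := leeD (SB n.+1) (outer_measure_sigma_subadditive_tail
    (@hausdorff1 R) n annulus).
  apply: le_trans; rewrite addeAC; apply: leeD => //.
  exact: (outer_measureU2 (@hausdorff1 R)).
rewrite -[leRHS]adde0.
have -> : H X + 0 = limn (fun n => H X + \sum_(n <= k <oo) H (annulus k)).
  by apply/esym/cvg_lim => //; apply: cvgeD => //; [exact: fin_num_adde_defr|
    exact: cvg_cst].
apply: lime_ge; last by apply: nearW => n; exact: bound.
apply/cvg_ex; exists (H X + 0); apply: cvgeD => //.
  exact: fin_num_adde_defr.
exact: cvg_cst.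
Qed.

End lipschitz.

Lemma caratheodory_lipschitz f :
  (forall x y, (`|f x - f y| <= eucl_dist x y)%R) ->
  (@hausdorff1 R).-caratheodory [set z | (0 < f z)%R].
Proof.
move=> f_lip; apply: le_caratheodory_measurable => X.
have [HX|HX] := ltP (hausdorff1 X) +oo; first exact: hausdorff1_lipschitz_split.
by apply: le_trans (leey _) HX.
Qed.

Lemma caratheodory_borel A : measurable A -> (@hausdorff1 R).-caratheodory A.
Proof.
have mpre f : (forall x y, (`|f x - f y| <= eucl_dist x y)%R) ->
    measurable_fun (setT : set (caratheodory_type (@hausdorff1 R))) f.
  move=> f_lip.
  apply: (measurability _ (measurable_realfun.RGenOInfty.measurableE R)).
  move=> _ [_ [a ->] <-]; rewrite setTI.
  have -> : f @^-1` `]a, +oo[ = [set z | (0 < f z - a)%R].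
    by apply/seteqP; split => z /=; rewrite in_itv/= andbT subr_gt0.
  apply: caratheodory_lipschitz => x y.
  by rewrite (_ : f x - a - (f y - a) = f x - f y)%R//; ring.
rewrite measurable_prod_measurableType; apply: smallest_sub.
  exact: (@sigma_algebra_measurable _ (caratheodory_type (@hausdorff1 R))).
move=> _ [B mB [C mC <-]].
have := measurableI _ _ (mpre fst (@eucl_dist_fst R) measurableT B mB)
  (mpre snd (@eucl_dist_snd R) measurableT C mC).
by rewrite !setTI.
Qed.

End hausdorff1_borel.

Definition hausdorff1_restr (R : realType) (K A : set (R * R)) : \bar R :=
  hausdorff1 (A `&` K).

Section hausdorff1_restr_measure.
Context (R : realType) (K : set (R * R)).

Let restr0 : hausdorff1_restr K set0 = 0.
Proof. by rewrite /hausdorff1_restr set0I hausdorff1_set0. Qed.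

Let restr_ge0 A : 0 <= hausdorff1_restr K A.
Proof. exact: hausdorff1_ge0. Qed.

Let restr_sigma_additive :
  semi_sigma_additive (hausdorff1_restr K : set (R * R)%type -> \bar R).
Proof.
move=> F mF tF mUF.
have HF X :
    hausdorff1 (X `&` \bigcup_k F k) = \sum_(k <oo) hausdorff1 (X `&` F k).
  apply/eqP; rewrite eq_le; apply/andP; split.
    exact: outer_measure_bigcup_lim.
  have := caratheodory_lime_le (mu := @hausdorff1 R)
    (fun n => caratheodory_borel (mF n)) tF (X `&` \bigcup_k F k).
  rewrite [Y in _ + hausdorff1 Y](_ : _ = set0) ?hausdorff1_set0 ?adde0;
    last first.
    by apply/seteqP; split => // z [[]].
  apply: le_trans.
  apply: lee_nneseries => k *; first exact: hausdorff1_ge0.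
  by apply: le_hausdorff1 => z [Xz Fz]; split => //; split => //; exists k.
rewrite /hausdorff1_restr setIC HF.
under eq_eseriesr do rewrite setIC.
by apply: is_cvg_nneseries => *; exact: hausdorff1_ge0.
Qed.

HB.instance Definition _ := isMeasure.Build _ (R * R)%type R
  (hausdorff1_restr K) restr0 restr_ge0 restr_sigma_additive.

End hausdorff1_restr_measure.

Local Close Scope ereal_scope.

Definition contracting_similarity (R : realType) (S : R * R -> R * R) : Prop :=
  exists2 r : R, 0 < r < 1 &
    forall x y, eucl_dist (S x) (S y) = r * eucl_dist x y.

(* [K !=set0] singles out the attractor among the compact solutions of the
   fixed-point equation (the other one is [set0]) and forces [0 < m]. *)
Definition self_similar (R : realType) (K : set (R * R)) : Prop :=
  exists (m : nat) (S : 'I_m -> R * R -> R * R),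
    [/\ forall i, contracting_similarity (S i), K !=set0, compact K &
        K = \bigcup_(i in [set: 'I_m]) (S i @` K)].

Definition one_set (R : realType) (K : set (R * R)) : Prop :=
  (0 < hausdorff1 K < +oo)%E.

Definition line_pt (R : realType) (theta t : R) : R * R :=
  (t * cos theta, t * sin theta).

Definition origin_line (R : realType) (theta : R) : set (R * R) :=
  [set line_pt theta t | t in [set: R]].

(* The orthogonal projection onto [origin_line theta], this line being
   identified with [R] through [line_pt theta]; see [line_proj_nearest]. *)
Definition line_proj (R : realType) (theta : R) (z : R * R) : R :=
  z.1 * cos theta + z.2 * sin theta.

Lemma line_proj_nearest (R : realType) (theta : R) (z : R * R) (t : R) :
  eucl_dist z (line_pt theta (line_proj theta z)) <=
  eucl_dist z (line_pt theta t).
Proof.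
rewrite ler_wsqrtr// -subr_ge0 /line_pt /line_proj /=.
have := cos2Dsin2 theta; move: (cos theta) (sin theta) => a b ab.
set p := z.1 * a + z.2 * b.
have -> : (z.1 - t * a) ^+ 2 + (z.2 - t * b) ^+ 2 -
    ((z.1 - p * a) ^+ 2 + (z.2 - p * b) ^+ 2) =
    (p - t) ^+ 2 + (t ^+ 2 - p ^+ 2) * (a ^+ 2 + b ^+ 2 - 1).
  by rewrite /p; ring.
by rewrite ab subrr mulr0 addr0 sqr_ge0.
Qed.

Definition centered_interval (R : realType) (c : R) : set R :=
  `[- (c / 2), c / 2]%classic.

(* Main.v *)
Require Import Defs.
From HB Require Import structures.
From mathcomp Require Import all_boot all_order all_algebra.
From mathcomp Require Import all_classical all_reals all_analysis.
From mathcomp Require Import measurable_realfun ring lra.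

Set Implicit Arguments.
Unset Strict Implicit.
Unset Printing Implicit Defensive.

Import Order.TTheory GRing.Theory Num.Theory.
Import numFieldNormedType.Exports.

Local Open Scope classical_set_scope.
Local Open Scope ring_scope.

(* Put [mu = H^1|_K]. If the projection of [K] in the direction [theta] is an
   interval [I], then the projection of [mu] is uniform on [I]. Indeed the
   powers of an orthogonal map come back close to the identity, so every
   interval [J] in [I] contains the projection of a copy of [K] of comparable
   size whose orthogonal part almost fixes the direction [theta]. That
   projection lies in an interval [J'] of length about [r |I|], [r] being the
   ratio of the copy, and has mass at least [r mu(K)]; hence the density of the
   projected measure is nowhere below [mu(K) / |I|], and it is not above either
   since the total mass is [mu(K)].

   Consequently the first two moments of the projected measure are those of a
   uniform distribution. The second moment is a quadratic form in
   [(cos theta, sin theta)] and the first one is linear, so their values on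
   three lines determine them in all directions, and therefore also determine
   every interval that occurs as a projection. *)

(** * Plane Euclidean geometry and linear parts of similarities *)

Section plane.
Context (R : realType).
Implicit Types (u v w x y z : R * R) (r : R) (A S : R * R -> R * R).

Definition dot u v : R := u.1 * v.1 + u.2 * v.2.

Lemma eucl_dist_sqr x y :
  eucl_dist x y ^+ 2 = (x.1 - y.1) ^+ 2 + (x.2 - y.2) ^+ 2.
Proof. by rewrite sqr_sqrtr// addr_ge0// sqr_ge0. Qed.

(** Cauchy-Schwarz for [u - v] and [x - y], arranged to compare projections in two directions; the
    defect is the square of a determinant. *)
Lemma dotB_le u v x y :
  dot u x - dot u y <=
  dot v x - dot v y + eucl_dist u v * eucl_dist x y.
Proof.
suff : dot u x - dot u y - (dot v x - dot v y) <= eucl_dist u v * eucl_dist x y.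
  by move=> ?; lra.
apply: le_trans (ler_norm _) _.
rewrite -ler_sqr ?nnegrE ?mulr_ge0 ?sqrtr_ge0// exprMn !eucl_dist_sqr.
rewrite real_normK ?num_real// /dot -subr_ge0.
move: u v x y => [u1 u2] [v1 v2] [x1 x2] [y1 y2] /=.
rewrite (_ : _ - _ = ((u1 - v1) * (x2 - y2) - (u2 - v2) * (x1 - y1)) ^+ 2).
  exact: sqr_ge0.
by ring.
Qed.

(** Pair [x - z] with [(x - y) + (y - z)], bound both terms by Cauchy-Schwarz and divide by the
    distance from [x] to [z]. *)
Lemma eucl_dist_triangle x y z :
  eucl_dist x z <= eucl_dist x y + eucl_dist y z.
Proof.
have [/eqP e|xz] := eqVneq (eucl_dist x z) 0.
  by move: e => /eqP ->; rewrite addr_ge0// eucl_dist_ge0.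
have xz0 : 0 < eucl_dist x z by rewrite lt_neqAle eq_sym xz eucl_dist_ge0.
rewrite -(ler_pM2l xz0) mulrDr.
have := dotB_le x z x y; have := dotB_le x z y z; have := eucl_dist_sqr x z.
by rewrite /dot; nra.
Qed.

Lemma eucl_distC x y : eucl_dist x y = eucl_dist y x.
Proof. by congr Num.sqrt; ring. Qed.

(** [S] is a translate of [r] times a linear isometry, and [A] is the transpose of that isometry. *)
Lemma similarity_adjoint r S : 0 < r ->
  (forall x y, eucl_dist (S x) (S y) = r * eucl_dist x y) ->
  exists A, [/\ A (0, 0) = (0, 0),
    forall v w, eucl_dist (A v) (A w) = eucl_dist v w &
    forall v x y, dot v (S x) - dot v (S y) = r * (dot (A v) x - dot (A v) y)].
Proof.
move=> r0 simS; have rN0 : r != 0 by rewrite gt_eqF.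
pose T z := (((S z).1 - (S (0, 0)).1) / r, ((S z).2 - (S (0, 0)).2) / r).
have STE z : S z = (r * (T z).1 + (S (0, 0)).1, r * (T z).2 + (S (0, 0)).2).
  by rewrite /T/= !(mulrC r) !divfK// !subrK -surjective_pairing.
have Tdist x y : ((T x).1 - (T y).1) ^+ 2 + ((T x).2 - (T y).2) ^+ 2 =
    (x.1 - y.1) ^+ 2 + (x.2 - y.2) ^+ 2.
  apply: (@mulfI _ (r ^+ 2)); first by rewrite expf_neq0.
  rewrite -(eucl_dist_sqr x y) -exprMn -simS eucl_dist_sqr !(STE x) !(STE y) /=.
  by ring.
have T0 : T (0, 0) = (0, 0) by rewrite /T !subrr !mul0r.
clearbody T.
(* Polarisation: an isometry fixing the origin preserves inner products. *)
have Tdot x y : dot (T x) (T y) = dot x y.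
  have := Tdist x y; have := Tdist x (0, 0); have := Tdist y (0, 0).
  by rewrite T0 /dot /= !subr0; lra.
pose a := T (1, 0); pose b := T (0, 1).
have TE z : T z = (z.1 * a.1 + z.2 * b.1, z.1 * a.2 + z.2 * b.2).
  (* This squared distance expands into inner products that [Tdot] evaluates, and they cancel. *)
  have : ((T z).1 - (z.1 * a.1 + z.2 * b.1)) ^+ 2 +
         ((T z).2 - (z.1 * a.2 + z.2 * b.2)) ^+ 2 = 0.
    have := Tdot z z; have := Tdot z (1, 0); have := Tdot z (0, 1).
    have := Tdot (0, 1) (1, 0); have := Tdot (0, 1) (0, 1).
    have := Tdot (1, 0) (1, 0); rewrite -/a -/b /dot/=.
    rewrite !(mulr0, mulr1, addr0, add0r).
    move: (T z) a b => [X Y] [a1 a2] [b1 b2] /= aa bb ba zb za zz.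
    rewrite (_ : _ + _ = (X * X + Y * Y)
      + z.1 ^+ 2 * (a1 * a1 + a2 * a2) + z.2 ^+ 2 * (b1 * b1 + b2 * b2)
      + 2 * z.1 * z.2 * (b1 * a1 + b2 * a2)
      - 2 * z.1 * (X * a1 + Y * a2)
      - 2 * z.2 * (X * b1 + Y * b2)); last by ring.
    by rewrite aa bb ba za zb zz; ring.
  move/eqP; rewrite paddr_eq0 ?sqr_ge0// !sqrf_eq0 !subr_eq0 => /andP[/eqP t1 /eqP t2].
  by rewrite (surjective_pairing (T z)) t1 t2.
exists (fun v => (dot v a, dot v b)); split.
- by rewrite /dot !mul0r addr0.
- move=> v w; congr Num.sqrt; rewrite /dot /=.
  have := Tdot (0, 1) (1, 0); have := Tdot (0, 1) (0, 1).
  have := Tdot (1, 0) (1, 0); rewrite -/a -/b /dot/=.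
  rewrite !(mulr0, mulr1, addr0, add0r).
  move: a.1 a.2 b.1 b.2 => a1 a2 b1 b2 aa bb ba.
  (* Orthonormal columns give orthonormal rows: [a] is [b] turned by a right angle, up to the sign
     [d]. *)
  pose d := a1 * b2 - a2 * b1.
  have ab2 : a2 * b2 = - (a1 * b1) by lra.
  have a1E : a1 = d * b2.
    transitivity (a1 * (b1 * b1 + b2 * b2)); first by rewrite bb mulr1.
    transitivity (a1 * b2 * b2 - b1 * (a2 * b2)); last by rewrite /d; ring.
    by rewrite ab2; ring.
  have a2E : a2 = - d * b1.
    transitivity (a2 * (b1 * b1 + b2 * b2)); first by rewrite bb mulr1.
    transitivity (a2 * b1 * b1 + b2 * (a2 * b2)); first by ring.
    by rewrite ab2 /d; ring.
  have dd : d * d = 1.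
    transitivity (d * d * (b1 * b1 + b2 * b2)); first by rewrite bb mulr1.
    by rewrite -aa [in RHS]a1E [in RHS]a2E; ring.
  transitivity ((d * d * b2 ^+ 2 + b1 ^+ 2) * (v.1 - w.1) ^+ 2 +
     (d * d * b1 ^+ 2 + b2 ^+ 2) * (v.2 - w.2) ^+ 2 +
     2 * (1 - d * d) * b1 * b2 * (v.1 - w.1) * (v.2 - w.2)).
    by rewrite a1E a2E; ring.
  rewrite dd !mul1r subrr mulr0 !mul0r addr0 [b2 ^+ 2 + _]addrC !expr2 bb.
  by rewrite !mul1r.
- move=> v x y; rewrite (STE x) (STE y) (TE x) (TE y) /dot /=.
  by ring.
Qed.

End plane.

(** * Small copies and the realignment of their directions *)

Section copies.
Context (R : realType).
Implicit Types (K : set (R * R)) (u v x y : R * R) (r : R).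
Implicit Types (A S : R * R -> R * R).

(* [S] maps [K] into itself with ratio [r], and [A] is the transpose of its
   linear part divided by [r]: the projection of the copy [S @` K] in the
   direction [v] is a translate of [r] times that of [K] in the direction
   [A v]. *)
Definition copy K r A S : Prop :=
  [/\ 0 < r <= 1, (forall z, K z -> K (S z)),
    forall x y, eucl_dist (S x) (S y) = r * eucl_dist x y,
    A (0, 0) = (0, 0) /\
    (forall v w, eucl_dist (A v) (A w) = eucl_dist v w) &
    forall v x y, dot v (S x) - dot v (S y) = r * (dot (A v) x - dot (A v) y)].

Lemma copy_id K : copy K 1 idfun idfun.
Proof. by split=> *; rewrite ?mul1r ?ltr01 ?lexx. Qed.

Lemma copy_comp K r r' A A' S S' : copy K r A S -> copy K r' A' S' ->
  copy K (r * r') (A' \o A) (S \o S').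
Proof.
move=> [/andP[r0 r1] SK dS [A0 dA] Sdot].
move=> [/andP[r'0 r'1] SK' dS' [A0' dA'] Sdot']; split => /=.
- by rewrite mulr_gt0//= mulr_ile1// ltW.
- by move=> z /SK' /SK.
- by move=> x y; rewrite dS dS' mulrA.
- by rewrite A0 A0'; split => // v w; rewrite dA' dA.
- by move=> v x y; rewrite Sdot Sdot' mulrA.
Qed.

Lemma copy_iter K r A S n : copy K r A S ->
  copy K (r ^+ n) (iter n A) (iter n S).
Proof.
move=> cS; elim: n => [|n IH]; first exact: copy_id.
rewrite exprSr.
have := copy_comp IH cS.
rewrite (_ : iter n S \o S = iter n.+1 S)//.
by apply/funext => z /=; rewrite -iterSr.
Qed.

Lemma similarity_copy K S : contracting_similarity S ->
  (forall z, K z -> K (S z)) -> exists r A, r < 1 /\ copy K r A S.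
Proof.
move=> [r /andP[r0 r1] dS] SK; have [A [A0 dA Sdot]] := similarity_adjoint r0 dS.
by exists r, A; split => //; split => //; rewrite r0 ltW.
Qed.

(** Follow an address of [z] until the product of the ratios falls below [d]: the last factor is at
    least [rho], the least ratio, so the product is not much smaller than [d]. *)
Lemma self_similar_copies K : self_similar K ->
  exists rho : R, 0 < rho /\
    forall (d : R) z, 0 < d <= 1 -> K z -> exists r A S,
      [/\ copy K r A S, rho * d <= r <= d & exists2 y, K y & S y = z].
Proof.
move=> [m [S [simS _ _ KE]]].
have SK i z : K z -> K (S i z) by move=> Kz; rewrite KE; exists i => //; exists z.
have /choice[r rP] : forall i, exists r : R, exists A, r < 1 /\ copy K r A (S i).
  by move=> i; exact: (similarity_copy (simS i) (SK i)).
have r01 i : 0 < r i < 1.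
  by have [A [ri1 [/andP[ri0 _] _ _ _ _]]] := rP i; rewrite ri0.
pose rho := \big[Num.min/1]_i r i; pose sigma := \big[Num.max/0]_i r i.
have rho0 : 0 < rho.
  rewrite /rho; elim/big_ind : _ => // [a b a0 b0|i _].
    by rewrite lt_min a0.
  by case/andP: (r01 i).
have sigma0 : 0 <= sigma.
  rewrite /sigma; elim/big_ind : _ => // [a b a0 b0|i _].
    by rewrite le_max a0.
  by case/andP: (r01 i) => /ltW.
have sigma1 : sigma < 1.
  rewrite /sigma; elim/big_ind : _ => // [a b a0 b0|i _].
    by rewrite gt_max a0.
  by case/andP: (r01 i).
have rho_le i : rho <= r i by rewrite /rho; exact: bigmin_le_cond.
have le_sigma i : r i <= sigma by rewrite /sigma; exact: le_bigmax_cond.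
exists rho; split => //.
(* [n] bounds the number of generations still to descend, as each one divides the target [d] by a
   ratio of at most [sigma]. *)
suff H n d z : 0 < d <= 1 -> sigma ^+ n <= d -> K z -> exists r A S,
    [/\ copy K r A S, rho * d <= r <= d & exists2 y, K y & S y = z].
  move=> d z d01 Kz; have /andP[d0 _] := d01.
  have [n nd] : exists n, sigma ^+ n <= d.
    have : sigma ^+ n @[n --> \oo] --> 0 by apply: cvg_expr; rewrite ger0_norm.
    move=> /cvgrPdist_le /(_ _ d0) [n _ /(_ n (leqnn n)) /=].
    by rewrite sub0r normrN ger0_norm ?exprn_ge0// => ?; exists n.
  exact: H n d z d01 nd Kz.
elim: n d z => [|n IH] d z /andP[d0 d1] nd Kz.
  have -> : d = 1 by apply/eqP; rewrite eq_le d1 -(expr0 sigma).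
  exists 1, idfun, idfun; split; [exact: copy_id| |by exists z].
  rewrite mulr1 lexx andbT.
  have [i _ _] : (\bigcup_(i in setT) (S i @` K)) z by rewrite -KE.
  by rewrite (le_trans (rho_le i))//; case/andP: (r01 i) => _ /ltW.
have [i _ [y Ky <-]] : (\bigcup_(i in setT) (S i @` K)) z by rewrite -KE.
have [ri0 ri1] := andP (r01 i).
have [A [_ cSi]] := rP i.
have [dri|rid] := leP d (r i).
  have [] := IH (d / r i) y _ _ Ky.
  - by rewrite divr_gt0//= ler_pdivrMr// mul1r.
  - rewrite ler_pdivlMr//; apply: le_trans nd.
    by rewrite exprSr ler_wpM2l// exprn_ge0.
  - move=> r' [A' [S' [cS' /andP[r'1 r'2] [x Kx S'x]]]].
    exists (r i * r'), (A' \o A), (S i \o S').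
    split; [exact: (copy_comp cSi cS')| |by exists x => //=; rewrite S'x].
    rewrite [r i * r']mulrC -ler_pdivrMr// -mulrA r'1 /=.
    by rewrite -ler_pdivlMr.
exists (r i), A, (S i); split => //; last by exists y.
rewrite (ltW rid) andbT; apply: le_trans (rho_le i).
by rewrite ler_piMr// ltW.
Qed.

(** Total boundedness in the form that the pigeonhole principle needs: in a grid of step [1 / N],
    each coordinate varies by less than [e / 2] within a cell. *)
Lemma unit_square_cells (e : R) : 0 < e -> exists (T : finType) (cell : R * R -> T),
  forall x y, eucl_dist x (0, 0) <= 1 -> eucl_dist y (0, 0) <= 1 ->
    cell x = cell y -> eucl_dist x y < e.
Proof.
move=> e0; pose N := (Num.truncn (2 / e)).+1.
have Ne : 2 / e < N%:R by exact: truncnS_gt.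
have N0 : 0 < (N%:R : R) by rewrite ltr0n.
(* For [t] in [-1, 1] the index runs from 0 to 2N, the top value occurring only at [t = 1]. *)
pose idx (t : R) : 'I_(N.*2).+1 := inord (Num.truncn ((t + 1) * N%:R)).
have idxP (s t : R) : `|s| <= 1 -> `|t| <= 1 -> idx s = idx t -> `|s - t| < e / 2.
  have trP (t' : R) : `|t'| <= 1 -> nat_of_ord (idx t') = Num.truncn ((t' + 1) * N%:R) /\
      ((Num.truncn ((t' + 1) * N%:R))%:R <= (t' + 1) * N%:R <
       (Num.truncn ((t' + 1) * N%:R)).+1%:R).
    rewrite ler_norml => /andP[t1 t2].
    have t0 : 0 <= (t' + 1) * N%:R by rewrite mulr_ge0 ?ler0n//; lra.
    split; last exact: truncn_itv.
    rewrite inordK// ltnS.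
    have : ((Num.truncn ((t' + 1) * N%:R))%:R : R) <= (N.*2)%:R.
      rewrite (le_trans (_ : _ <= (t' + 1) * N%:R))//.
        by case/andP: (truncn_itv t0).
      by rewrite -mul2n natrM ler_wpM2r ?ler0n//; lra.
    by rewrite ler_nat.
  move=> /trP[sE /andP[s1 s2]] /trP[tE /andP[t1 t2]] /(congr1 (@nat_of_ord _)).
  rewrite sE tE => E; move: s1 s2 t1 t2; rewrite E.
  set k := Num.truncn _; rewrite -natr1 => s1 s2 t1 t2.
  have : `|s - t| * N%:R < 1.
    rewrite -[X in _ * X]gtr0_norm// -normrM ltr_norml; apply/andP; split; lra.
  have : 2 < N%:R * e by rewrite -ltr_pdivrMr.
  move: `|s - t| (normr_ge0 (s - t)) (N%:R) N0 => a a0 M M0 h1 h2.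
  by nra.
exists ('I_(N.*2).+1 * 'I_(N.*2).+1)%type, (fun x => (idx x.1, idx x.2)).
have bnd x : eucl_dist x (0, 0) <= 1 -> `|x.1| <= 1 /\ `|x.2| <= 1.
  move=> x1; have := eucl_dist_fst x (0, 0); have := eucl_dist_snd x (0, 0).
  by rewrite /= !subr0 => ? ?; split; apply: le_trans x1.
move=> x y /bnd[x1 x2] /bnd[y1 y2] [] /(idxP _ _ x1 y1) d1 /(idxP _ _ x2 y2) d2.
rewrite -ltr_sqr ?nnegrE ?eucl_dist_ge0//; last exact: ltW.
rewrite eucl_dist_sqr -[(x.1 - _) ^+ 2]real_normK ?num_real//.
rewrite -[(x.2 - _) ^+ 2]real_normK ?num_real//.
move: `|x.1 - y.1| `|x.2 - y.2| (normr_ge0 (x.1 - y.1)) (normr_ge0 (x.2 - y.2)) d1 d2.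
by move=> a b a0 b0 ? ?; nra.
Qed.

Lemma iter_dist A (n : nat) v w :
  (forall v w, eucl_dist (A v) (A w) = eucl_dist v w) ->
  eucl_dist (iter n A v) (iter n A w) = eucl_dist v w.
Proof. by move=> dA; elim: n => //= n IH; rewrite dA. Qed.

(* Among the directions [A^k u] two are close by pigeonhole, hence so are [u]
   and some [A^(k+1) u], [A] being an isometry. *)
Lemma copy_recurrent K r A S u (e : R) : 0 < e -> eucl_dist u (0, 0) <= 1 ->
  copy K r A S -> exists r' A' S', copy K r' A' S' /\ eucl_dist (A' (A u)) u < e.
Proof.
move=> e0 u1 cS; have [_ _ _ [A0 dA] _] := cS.
have [T [cell cellP]] := unit_square_cells e0.
pose f (i : 'I_#|T|.+1) := cell (iter i A u).
have iterA0 n : iter n A (0, 0) = (0, 0) by elim: n => //= n ->.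
have /injectivePn[i [j ij fij]] : ~~ injectiveb f.
  apply/injectiveP => /leq_card; rewrite card_ord.
  by rewrite ltnn.
have close (k l : nat) : cell (iter k A u) = cell (iter l A u) ->
    (k < l)%N -> exists r' A' S', copy K r' A' S' /\ eucl_dist (A' (A u)) u < e.
  move=> kl lt_kl.
  have in1 n : eucl_dist (iter n A u) (0, 0) <= 1 by rewrite -(iterA0 n) iter_dist.
  move: (cellP _ _ (in1 k) (in1 l) kl).
  (* The first [k] iterates cancel by isometry. Of the other [l - k], one is the given [A], so the
     correcting copy uses [l - k.+1], possibly none. *)
  rewrite -(subnKC lt_kl) addSnnS iterD iter_dist// eucl_distC iterSr => d.
  by exists (r ^+ (l - k.+1)), (iter (l - k.+1) A), (iter (l - k.+1) S); split;
    first exact: copy_iter.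
have [lt_ij|lt_ji|ijE] := ltngtP (i : nat) j.
- exact: close lt_ij.
- exact: close lt_ji.
- by move/eqP: ij; case; exact: val_inj.
Qed.

(* The directions [A u] fall into finitely many cells, and the correction that
   brings one of them back to [u] works for its whole cell. *)
Lemma copy_realign K u (e : R) : 0 < e -> eucl_dist u (0, 0) <= 1 ->
  exists kappa : R, 0 < kappa /\ forall r A S, copy K r A S ->
    exists r' A' S', [/\ copy K r' A' S', kappa <= r' &
      eucl_dist (A' (A u)) u <= e].
Proof.
move=> e0 u1; have e20 : 0 < e / 2 by rewrite divr_gt0.
have [T [cell cellP]] := unit_square_cells e20.
have /choice[k kP] : forall t : T, exists k : R, 0 < k /\
    forall r A S, copy K r A S -> cell (A u) = t -> exists r' A' S',
      [/\ copy K r' A' S', k <= r' & eucl_dist (A' (A u)) u <= e].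
  move=> t.
  have [[r0 [A0 [S0 [cS0 ct0]]]]|no] :=
      pselect (exists r0 A0 S0, copy K r0 A0 S0 /\ cell (A0 u) = t); last first.
    by exists 1; split => // r A S cS ct; case: no; exists r, A, S.
  have [r' [A' [S' [cS' close]]]] := copy_recurrent e20 u1 cS0.
  have [/andP[r'0 _] _ _ [_ dA'] _] := cS'.
  exists r'; split => // r A S cS ct; exists r', A', S'; split => //.
  have [_ _ _ [A00 dA0] _] := cS0; have [_ _ _ [Az dA] _] := cS.
  have : eucl_dist (A u) (A0 u) < e / 2.
    have Au1 : eucl_dist (A u) (0, 0) <= 1 by rewrite -[X in eucl_dist _ X]Az dA.
    have A0u1 : eucl_dist (A0 u) (0, 0) <= 1.
      by rewrite -[X in eucl_dist _ X]A00 dA0.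
    by apply: cellP => //; rewrite ct ct0.
  have := eucl_dist_triangle (A' (A u)) (A' (A0 u)) u.
  by rewrite dA'; lra.
exists (\big[Num.min/1]_t k t); split.
  elim/big_ind : _ => // [a b a0 b0|t _]; first by rewrite lt_min a0.
  by case: (kP t).
move=> r A S cS; have [_ /(_ _ _ _ cS erefl)] := kP (cell (A u)).
move=> [r' [A' [S' [cS' kr close]]]]; exists r', A', S'; split => //.
by apply: le_trans kr; exact: bigmin_le_cond.
Qed.

End copies.

(** * Hausdorff measure of a copy, and projections as linear functionals *)

(** A cover of the image pulls back to a cover of [A] with diameters divided by [r], so scale
    [r * d] on the image matches scale [d] on [A]. *)
Lemma hausdorff1_image_ge (R : realType) (r : R) (S : R * R -> R * R)
    (A : set (R * R)) : 0 < r ->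
  (forall x y, eucl_dist (S x) (S y) = r * eucl_dist x y) ->
  (r%:E * hausdorff1 A <= hausdorff1 (S @` A))%E.
Proof.
move=> r0 dS.
have diam_preimage U : (eucl_diam (S @^-1` U) <= (r^-1)%:E * eucl_diam U)%E.
  rewrite ge_max; apply/andP; split.
    by rewrite mule_ge0 ?eucl_diam_ge0 ?lee_fin ?invr_ge0 ?ltW.
  apply: ge_ereal_sup => _ [[x y] [/= Ux Uy] <-].
  rewrite lee_pdivlMl// -EFinM -dS; exact: eucl_dist_le_diam.
rewrite -lee_pdivlMl//; apply: ge_ereal_sup => _ [d d0 <-].
rewrite lee_pdivlMl//.
have rd0 : 0 < r * d by rewrite mulr_gt0.
apply: le_trans (hausdorff1_pre_le_hausdorff1 _ rd0).
apply: le_ereal_inf_tmp => _ [U [Ud AU] <-].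
rewrite -lee_pdivlMl// -nneseriesZl//; last by move=> *; exact: eucl_diam_ge0.
apply: le_trans (@hausdorff1_pre_le _ d (fun k => S @^-1` U k) _ _ _) _.
- move=> k; apply: le_trans (diam_preimage _) _.
  by rewrite lee_pdivrMl// -EFinM.
- by move=> z Az; have [k _ Uk] := AU (S z) (ex_intro2 _ _ z Az erefl); exists k.
- by apply: lee_nneseries => [k _ _|k _]; [exact: eucl_diam_ge0|].
Qed.

Section projection.
Context (R : realType).
Implicit Types (K : set (R * R)) (theta : R).

Definition direction theta : R * R := (cos theta, sin theta).

Lemma line_projE theta z : line_proj theta z = dot (direction theta) z.
Proof. by rewrite /line_proj /dot/= !(mulrC (cos _)) !(mulrC (sin _)). Qed.

Lemma direction_norm theta : eucl_dist (direction theta) (0, 0) = 1.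
Proof. by rewrite /eucl_dist !subr0 cos2Dsin2 sqrtr1. Qed.

Lemma measurable_line_proj theta :
  measurable_fun [set: R * R] (line_proj theta).
Proof.
by apply: measurable_funD; apply: measurable_funM.
Qed.

Lemma compact_eucl_dist K : compact K ->
  exists D : R, 1 <= D /\ forall x y, K x -> K y -> eucl_dist x y <= D.
Proof.
move=> /compact_bounded[M [_ /(_ (`|M| + 1)) Mb]].
have {}Mb x : K x -> `|x| <= `|M| + 1.
  by apply: Mb; rewrite (le_lt_trans (ler_norm M))// ltrDl.
have M0 := normr_ge0 M.
(* Distances are at most 2 sqrt(2) times a bound on the sup norm; 4 is a simple larger factor. *)
exists (4 * (`|M| + 1)); split; first lra.
move=> x y /Mb; rewrite prod_normE ge_max => /andP[x1 x2].
move=> /Mb; rewrite prod_normE ge_max => /andP[y1 y2].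
rewrite -ler_sqr; [|exact: eucl_dist_ge0|by rewrite nnegrE; lra].
rewrite eucl_dist_sqr; move: x1 x2 y1 y2; rewrite !ler_norml.
move: `|M| M0 => m m0 /andP[? ?] /andP[? ?] /andP[? ?] /andP[? ?].
have sq (s t : R) : - (m + 1) <= s -> s <= m + 1 -> - (m + 1) <= t ->
    t <= m + 1 -> (s - t) ^+ 2 <= (2 * (m + 1)) ^+ 2.
  by move=> *; rewrite -subr_ge0 subr_sqr mulr_ge0//; lra.
apply: le_trans (lerD (sq _ _ _ _ _ _) (sq _ _ _ _ _ _)) _ => //.
by rewrite -subr_ge0; nra.
Qed.

End projection.

(** * The projected mass *)

Section mass.
Context (R : realType) (K : set (R * R)) (theta : R).
Hypothesis HKoo : (hausdorff1 K < +oo)%E.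

Definition mass : R := fine (hausdorff1 K).

(** The pushforward of the restricted measure under the projection; [fine] loses nothing once [K]
    has finite measure. *)
Definition proj_mass (J : set R) : R :=
  fine (hausdorff1_restr K (line_proj theta @^-1` J)).

Lemma massE : hausdorff1 K = mass%:E.
Proof. by rewrite fineK// ge0_fin_numE// hausdorff1_ge0. Qed.

Lemma proj_massE J :
  hausdorff1_restr K (line_proj theta @^-1` J) = (proj_mass J)%:E.
Proof.
rewrite fineK// ge0_fin_numE ?hausdorff1_ge0//; apply: le_lt_trans HKoo.
by apply: le_hausdorff1 => z [].
Qed.

Lemma proj_mass_ge0 J : 0 <= proj_mass J.
Proof. exact/fine_ge0/hausdorff1_ge0. Qed.

Lemma proj_massU I J : measurable I -> measurable J -> I `&` J = set0 ->
  proj_mass (I `|` J) = proj_mass I + proj_mass J.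
Proof.
move=> mI mJ IJ; apply: EFin_inj; rewrite EFinD -!proj_massE preimage_setU.
have mpre J' : measurable J' -> measurable (line_proj theta @^-1` J').
  by move=> mJ'; rewrite -[_ @^-1` _]setTI; exact: measurable_line_proj.
rewrite measureU//; [exact: mpre..|].
by rewrite -preimage_setI IJ preimage_set0.
Qed.

Lemma le_proj_mass I J : I `<=` J -> proj_mass I <= proj_mass J.
Proof.
move=> IJ; rewrite -lee_fin -!proj_massE; apply: le_hausdorff1 => z [Iz Kz].
by split => //; exact: IJ.
Qed.

Lemma proj_mass_full J : line_proj theta @` K `<=` J -> proj_mass J = mass.
Proof.
move=> KJ; congr (fine _); rewrite /hausdorff1_restr.
by congr hausdorff1; apply/seteqP; split => [z []//|z Kz]; split => //;
  apply: KJ; exists z.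
Qed.

Lemma copy_mass_le r A S J : copy K r A S ->
  (forall z, K z -> J (line_proj theta (S z))) -> r * mass <= proj_mass J.
Proof.
move=> [/andP[r0 _] SK dS _ _] KJ.
rewrite -lee_fin EFinM -massE -proj_massE.
apply: le_trans (hausdorff1_image_ge _ r0 dS) _.
by apply: le_hausdorff1 => _ [z Kz <-]; split; [exact: KJ|exact: SK].
Qed.

End mass.

(** * Lower bound for the projected mass of an interval *)

Section interval_projection.
Context (R : realType) (K : set (R * R)) (theta p q : R).
Hypothesis K_self_similar : self_similar K.
Hypothesis HKoo : (hausdorff1 K < +oo)%E.
Hypothesis pq : p < q.
Hypothesis projK : line_proj theta @` K = `[p, q]%classic.

Let P := line_proj theta.
Let nu := proj_mass K theta.
Let mu := mass K.

Let projP z : K z -> p <= P z <= q.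
Proof.
by move=> Kz; have : (P @` K) (P z) by [exists z]; rewrite projK /= in_itv.
Qed.

(* A copy of [K] whose direction is [e]-close to [theta] projects into an
   interval of length [q - p + O(e)] times its ratio, because [K] itself
   projects onto [[p, q]]. *)
Let subinterval_copy (D e : R) : 1 <= D ->
  (forall x y, K x -> K y -> eucl_dist x y <= D) -> 0 < e <= 1 ->
  exists k : R, 0 < k <= 1 /\ forall a b, p <= a -> a < b -> b <= q ->
    exists c d : R, [/\ a < c, c <= d, d < b, k * (b - a) <= d - c &
      mu * (d - c) <= nu `[c, d]%classic * (q - p + e * D)].
Proof.
move=> D1 KD /andP[e0 e1].
have D0 : 0 < D by lra.
pose u := direction theta.
have PE z : P z = dot u z by exact: line_projE.
have u1 : eucl_dist u (0, 0) <= 1 by rewrite direction_norm.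
have [rho [rho0 copies]] := self_similar_copies K_self_similar.
have [kappa [kappa0 realign]] := copy_realign K e0 u1.
have dirD v x y : K x -> K y ->
    dot v x - dot v y <= P x - P y + eucl_dist v u * D.
  move=> Kx Ky; rewrite !PE (le_trans (dotB_le v u x y))// lerD2l.
  by rewrite ler_wpM2l ?eucl_dist_ge0// KD.
have qpD : q - p <= D.
  have [x Kx Px] : (P @` K) q by rewrite projK /= in_itv/= lexx ltW.
  have [y Ky Py] : (P @` K) p by rewrite projK /= in_itv/= lexx ltW.
  have := dotB_le u (0, 0) x y.
  rewrite -!PE Px Py direction_norm /dot !mul0r addr0 subrr add0r mul1r.
  by move=> /le_trans; apply; exact: KD.
(* The final ratio will be at least [rho * d * kappa] with [d = (b - a) / (8 * D)], and the interval
   at least [q - p] times as long; [k] collects these factors. *)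
pose k := kappa * rho * (q - p) / (8 * D).
have k0 : 0 < k by rewrite divr_gt0 ?mulr_gt0 ?subr_gt0.
exists (Num.min k 1); rewrite lt_min k0 ltr01 ge_min lexx orbT; split => //.
move=> a b pa ab bq; pose d := (b - a) / (8 * D).
have d0 : 0 < d by rewrite divr_gt0 ?mulr_gt0 ?subr_gt0.
have dD : d * D = (b - a) / 8.
  by rewrite /d; field; rewrite gt_eqF.
have d1 : d <= 1.
  by rewrite /d ler_pdivrMr ?mulr_gt0// mul1r; lra.
pose m := (a + b) / 2.
have [z Kz Pz] : (P @` K) m.
  by rewrite projK /= in_itv /=; apply/andP; split; rewrite /m; lra.
have [|r [A [S [cS /andP[r1 r2] [y Ky Sy]]]]] := copies d z _ Kz.
  by rewrite d0.
have [r' [A' [S' [cS' kr' close]]]] := realign _ _ _ cS.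
have [/andP[r0 _] SK _ [A0 dA] SdotE] := cS.
have [/andP[r'0 r'1] S'K _ [A'0 dA'] _] := cS'.
have cT := copy_comp cS cS'; pose s := r * r'.
have [_ TK _ _ TdotE] := cT.
have s0 : 0 < s by rewrite mulr_gt0.
(* The realigned copy lies inside the first one, which contains [z] over the midpoint [m] and has
   projection of diameter at most [d * D]. *)
have near_m x : K x -> `|P (S (S' x)) - m| <= (b - a) / 8.
  move=> Kx; rewrite -Pz -Sy !PE SdotE normrM gtr0_norm//.
  have Au1 : eucl_dist (A u) u <= 2.
    apply: le_trans (eucl_dist_triangle _ (0, 0) _) _.
    by rewrite -[X in eucl_dist _ X + _]A0 dA (eucl_distC _ u) direction_norm; lra.
  have Av x' y' : K x' -> K y' -> dot (A u) x' - dot (A u) y' <= D.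
    move=> Kx' Ky'; apply: le_trans (dotB_le (A u) (0, 0) x' y') _.
    rewrite -[X in eucl_dist _ X]A0 dA direction_norm /dot !mul0r !addr0 subrr.
    by rewrite add0r mul1r KD.
  have : `|dot (A u) (S' x) - dot (A u) y| <= D.
    rewrite ler_norml; apply/andP; split; last by apply: Av => //; exact: S'K.
    by rewrite lerNl opprB; apply: Av => //; exact: S'K.
  move: (`|_|) (normr_ge0 (dot (A u) (S' x) - dot (A u) y)) => t t0 tD.
  have : r * t <= d * D by rewrite ler_pM// ltW.
  by rewrite dD; lra.
pose L := q - p + e * D.
have width x x' : K x -> K x' -> P (S (S' x)) - P (S (S' x')) <= s * L.
  move=> Kx Kx'; rewrite !PE [leLHS]TdotE /= ler_pM2l//.
  apply: le_trans (dirD (A' (A u)) x x' Kx Kx') _.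
  have := projP Kx; have := projP Kx' => /andP[? ?] /andP[? ?].
  by apply: lerD; [lra|rewrite ler_pM2r].
pose E := [set P (S (S' x)) | x in K].
have En0 : E !=set0 by exists (P (S (S' z))), z.
have Elb : has_lbound E.
  exists (m - (b - a) / 8) => _ [x Kx <-].
  by have := near_m x Kx; rewrite ler_norml => /andP[]; lra.
(* The lower end of the projected copy. The upper end will be [c + s * L], not the supremum, so that
   the length is exactly [s * L]. *)
pose c := inf E.
have cle x : K x -> c <= P (S (S' x)).
  by move=> Kx; apply: ge_inf => //; exists x.
have lec x : K x -> P (S (S' x)) - s * L <= c.
  move=> Kx; apply: lb_le_inf => // _ [x' Kx' <-].
  by have := width x x' Kx Kx'; lra.
have L0 : 0 < L by rewrite addr_gt0 ?subr_gt0 ?mulr_gt0.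
have LD : L <= 2 * D by rewrite /L; nra.
have sd : s <= d by rewrite (le_trans _ r2)// ler_piMr// ltW.
have sLd : s * L <= (b - a) / 4.
  have : s * L <= d * (2 * D) by rewrite ler_pM// ltW.
  by rewrite mulrCA dD; lra.
have ca : a < c.
  have := lec z Kz; have := near_m z Kz; rewrite ler_norml => /andP[] .
  suff : m - (b - a) / 8 <= c by rewrite /m; lra.
  apply: lb_le_inf => // _ [x Kx <-].
  by have := near_m x Kx; rewrite ler_norml => /andP[]; lra.
exists c, (c + s * L); split => //.
- by rewrite lerDl mulr_ge0// ltW.
- have := cle z Kz; have := near_m z Kz; rewrite ler_norml => /andP[_].
  by rewrite /m; lra.
- rewrite [c + s * L - c]addrC addKr (le_trans (_ : _ <= k * (b - a)))//.
    by rewrite ler_pM2r ?subr_gt0// ge_min lexx.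
  rewrite (_ : k * (b - a) = (rho * d * kappa) * (q - p)); last first.
    by rewrite /k /d; field; rewrite gt_eqF.
  have rd0 : 0 <= rho * d by rewrite mulr_ge0// ltW.
  apply: ler_pM.
  + by rewrite mulr_ge0// ltW.
  + by rewrite subr_ge0 ltW.
  + by apply: ler_pM => //; exact: ltW.
  + by rewrite lerDl mulr_ge0// ltW.
- rewrite [c + s * L - c]addrC addKr mulrA ler_pM2r// mulrC.
  apply: (copy_mass_le (theta := theta) HKoo cT) => x Kx.
  rewrite /= in_itv /= cle//=.
  by have := lec x Kx; rewrite -/P; lra.
Qed.

Let nuD a b c d : a < c -> c <= d -> d < b ->
  nu `]a, b[%classic =
  nu `]a, c[%classic + nu `[c, d]%classic + nu `]d, b[%classic.
Proof.
move=> ac cd db.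
rewrite -!proj_massU//; first last.
- by apply/seteqP; split => // x [] /=; rewrite !in_itv /= => /andP[? ?] /andP[? ?]; lra.
- apply/seteqP; split => // x [] [] /=; rewrite !in_itv /= => /andP[? ?] /andP[? ?]; lra.
- exact: measurableU.
congr nu; apply/seteqP; split => x /=; rewrite !in_itv /=.
  move=> /andP[ax xb]; have [xc|cx] := ltP x c; first by left; left; rewrite ax.
  by have [xd|dx] := leP x d; [left; right|right; rewrite xb].
by move=> [[|]|] /andP[? ?]; apply/andP; split; lra.
Qed.

(* Let [mm] be the infimum of [nu J / |J|] over open [J]. A closed subinterval
   making up a fixed proportion of [J] has ratio about [mu / (q - p)], and the
   rest of [J] has ratio at least [mm]; so [mm] cannot be smaller. *)
Lemma proj_mass_ge a b : p <= a -> a < b -> b <= q ->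
  mu * (b - a) <= nu `]a, b[%classic * (q - p).
Proof.
have Kc : compact K by case: K_self_similar => m [S []].
have [D [D1 KD]] := compact_eucl_dist Kc.
have D0 : 0 < D by lra.
have mu0 : 0 <= mu by exact/fine_ge0/hausdorff1_ge0.
move=> pa ab bq.
suff H e : 0 < e <= 1 -> mu * (b - a) <= nu `]a, b[%classic * (q - p + e * D).
  apply/ler_addgt0Pr => eps eps0.
  have nu0 : 0 <= nu `]a, b[%classic by exact: proj_mass_ge0.
  (* The [+ 1] keeps the denominator positive when the interval has no mass. *)
  pose e := Num.min 1 (eps / ((nu `]a, b[%classic + 1) * D)).
  have e0 : 0 < e by rewrite lt_min ltr01 divr_gt0// mulr_gt0//; lra.
  have e1 : e <= 1 by rewrite ge_min lexx.
  apply: le_trans (H e _) _; first by rewrite e0.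
  rewrite mulrDr lerD2l.
  have : e <= eps / ((nu `]a, b[%classic + 1) * D) by rewrite ge_min lexx orbT.
  rewrite ler_pdivlMr; last by rewrite mulr_gt0//; lra.
  by apply: le_trans; nra.
move=> /[dup] /andP[e0 e1] e01.
have [k [/andP[k0 k1] sub]] := subinterval_copy D1 KD e01.
pose L := q - p + e * D.
have L0 : 0 < L by rewrite addr_gt0 ?subr_gt0 ?mulr_gt0.
pose ratios := [set t | exists a b, [/\ p <= a, a < b, b <= q &
  t = nu `]a, b[%classic / (b - a)]].
have ratios0 : has_lbound ratios.
  exists 0 => _ [a' [b' [_ ab' _ ->]]].
  by rewrite divr_ge0 ?proj_mass_ge0// subr_ge0 ltW.
have ratiosn0 : ratios !=set0 by exists (nu `]a, b[%classic / (b - a)), a, b.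
pose mm := inf ratios.
have mmP a' b' : p <= a' -> a' <= b' -> b' <= q ->
    mm * (b' - a') <= nu `]a', b'[%classic.
  move=> pa'; rewrite le_eqVlt => /orP[/eqP <- _|ab' bq'].
    by rewrite subrr mulr0 proj_mass_ge0.
  rewrite -ler_pdivlMr ?subr_gt0//; apply: ge_inf => //.
  by exists a', b'.
suff Lmm : mu / L <= mm.
  rewrite -ler_pdivrMr// mulrAC; apply: le_trans (mmP _ _ pa (ltW ab) bq).
  by rewrite ler_pM2r ?subr_gt0.
rewrite leNgt; apply/negP => lt_mm.
(* The closed piece, at least a fraction [k] of the interval, gains [mu / L - mm] per unit length
   over the bound [mm]; this would lift the infimum above itself. *)
have : mm + (mu / L - mm) * k <= mm.
  apply: lb_le_inf => // _ [a' [b' [pa' ab' bq' ->]]].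
  have [c [d [ac cd db kcd mucd]]] := sub a' b' pa' ab' bq'.
  rewrite ler_pdivlMr ?subr_gt0// (nuD ac cd db).
  have h1 := mmP a' c pa' (ltW ac) (ltac:(lra)).
  have h2 := mmP d b' (ltac:(lra)) (ltW db) bq'.
  have : mu / L * (d - c) <= nu `[c, d]%classic.
    by rewrite mulrAC ler_pdivrMr.
  have : (mu / L - mm) * (k * (b' - a')) <= (mu / L - mm) * (d - c).
    by rewrite ler_pM2l// subr_gt0.
  lra.
by rewrite gerDl leNgt mulr_gt0// subr_gt0.
Qed.

End interval_projection.

(** * Uniformity of the projected measure and its second moment *)

Section second_moment.
Context (R : realType).
Implicit Types (K : set (R * R)) (theta p q s : R).

(** The difference of cubes is kept factored so that [q - p] cancels against the density. The shift
    [s] later yields first moments from nonnegative integrands. *)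
Lemma integral_sqr_itv p q s : p < q ->
  (\int[lebesgue_measure]_(t in `[p, q]) ((t + s) ^+ 2)%:E =
   ((q - p) * (((p + s) ^+ 2 + (p + s) * (q + s) + (q + s) ^+ 2) / 3))%:E)%E.
Proof.
move=> pq; pose F : R -> R := 3^-1 *: ((id + cst s) ^+ 3).
have dF (t : R) : is_derive t (1 : R) F ((t + s) ^+ 2).
  apply: is_derive_eq.
  transitivity (3^-1 * (3 * (t + s) ^+ 2 * (1 + 0))) => //.
  by rewrite addr0 mulr1 mulKf// pnatr_eq0.
have FE (t : R) : F t = 3^-1 * (t + s) ^+ 3 by [].
have cF : continuous F.
  by move=> t; apply/differentiable_continuous/derivable1_diffP; case: (dF t).
rewrite (@continuous_FTC2 _ _ F)//.
- by rewrite -EFinB; congr EFin; rewrite !FE; field.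
- apply: continuous_subspaceT => t.
  apply: (@continuous_comp _ _ _ (fun u : R => u + s) (fun u => u ^+ 2)).
    by apply: cvgD; [exact: cvg_id|exact: cvg_cst].
  exact: exprn_continuous.
- split; first by move=> t _; case: (dF t).
    by apply: cvg_at_right_filter; exact: cF.
  by apply: cvg_at_left_filter; exact: cF.
- by move=> t _; rewrite derive1E (@derive_val _ _ _ _ _ _ _ (dF t)).
Qed.

(** The lower bounds on the middle interval and on the two side intervals already add up to the
    total mass, so each is an equality. *)
Lemma proj_mass_interval K theta p q a b (J : set R) : self_similar K ->
  (hausdorff1 K < +oo)%E -> p < q -> line_proj theta @` K = `[p, q]%classic ->
  p <= a -> a <= b -> b <= q -> measurable J ->
  `]a, b[%classic `<=` J -> J `<=` `[a, b]%classic ->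
  proj_mass K theta J = mass K * ((b - a) / (q - p)).
Proof.
move=> ssK HKoo pq projK pa ab bq mJ abJ Jab.
have qp0 : 0 < q - p by rewrite subr_gt0.
have mu0 : 0 <= mass K by exact/fine_ge0/hausdorff1_ge0.
have ge c d : p <= c -> c <= d -> d <= q ->
    mass K * (d - c) <= proj_mass K theta `]c, d[%classic * (q - p).
  move=> pc; rewrite le_eqVlt => /orP[/eqP <- _|cd dq].
    by rewrite subrr mulr0 mulr_ge0 ?proj_mass_ge0// ltW.
  exact: proj_mass_ge.
have total : proj_mass K theta `]p, a[%classic + proj_mass K theta J
    + proj_mass K theta `]b, q[%classic <= mass K.
  rewrite -!proj_massU//.
  - rewrite -(@proj_mass_full _ K theta `[p, q]%classic); last by rewrite projK.
    apply: le_proj_mass => // x [[|/Jab]|] /=; rewrite !in_itv /=;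
      by move=> /andP[? ?]; apply/andP; split; lra.
  - exact: measurableU.
  - apply/seteqP; split => // x [] [|/Jab] /=; rewrite !in_itv /=.
      move=> /andP[_ xa] /andP[bx _].
      by have := lt_trans (lt_le_trans xa ab) bx; rewrite ltxx.
    by move=> /andP[_ xb] /andP[/(le_lt_trans xb)]; rewrite ltxx.
  - apply/seteqP; split => // x [] /= + /Jab; rewrite /= !in_itv /=.
    by move=> /andP[_ xa] /andP[/(lt_le_trans xa)]; rewrite ltxx.
have l1 := ge p a (lexx _) pa (le_trans ab bq).
have l2 := ge b q (le_trans pa ab) bq (lexx _).
have l3 := ge a b pa ab bq.
have l4 := le_proj_mass theta HKoo abJ.
have l5 : proj_mass K theta `]a, b[%classic * (q - p) <=
    proj_mass K theta J * (q - p) by rewrite ler_wpM2r// ltW.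
have l6 := ler_wpM2r (ltW qp0) total.
apply: (mulIf (lt0r_neq0 qp0)); rewrite mulrA divfK ?lt0r_neq0//.
by apply/eqP; rewrite eq_le; apply/andP; split; lra.
Qed.

(** The pushforward is [mass K] times the uniform law: both are finite and agree on the rays []-oo,
    x[], which are closed under intersection and generate the Borel sets. *)
Lemma integral_line_proj K theta p q (f : R -> R) : self_similar K ->
  (hausdorff1 K < +oo)%E -> p < q -> line_proj theta @` K = `[p, q]%classic ->
  measurable_fun setT f -> (forall t, 0 <= f t) ->
  (\int[hausdorff1_restr K]_z (f (line_proj theta z))%:E =
   (mass K / (q - p))%:E * \int[lebesgue_measure]_(t in `[p, q]) (f t)%:E)%E.
Proof.
move=> ssK HKoo pq projK mf f0.
have qp0 : 0 < q - p by rewrite subr_gt0.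
pose T := measurableTypeR R; pose P : R * R -> T := line_proj theta.
have mP : measurable_fun setT P by exact: measurable_line_proj.
pose m1' : {measure set T -> \bar R} := pushforward (hausdorff1_restr K) P.
pose m1 := m1' mP.
pose m2 : {measure set T -> \bar R} :=
  mscale (NngNum (fine_ge0 (hausdorff1_ge0 K))) (uniform_prob pq).
have m1E A : m1 A = (proj_mass K theta A)%:E by rewrite -proj_massE.
have m12 (A : set T) : measurable A -> m1 A = m2 A.
  apply: (@measure_unique _ R T (@RGenInftyO.G R) (fun n => `]-oo, n%:R[%classic)).
  - exact: RGenInftyO.measurableE.
  - move=> _ _ [x ->] [y ->]; exists (Num.min x y).
    by apply/seteqP; split => t /=; rewrite !in_itv /= lt_min => /andP.
  - by move=> n; exists n%:R.
  - apply/seteqP; split => // t _; exists (Num.truncn `|t|).+1 => //=.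
    by rewrite in_itv /= (le_lt_trans (ler_norm t))// truncnS_gt.
  - move=> _ [x ->].
    have m2E A' : m2 A' = ((mass K)%:E * uniform_prob pq A')%E by [].
    rewrite m1E m2E /uniform_prob integral_uniform_pdf.
    (* [b] is [x] clamped to [[p, q]], and [B] is the interval from [p] to [b] up to endpoints. *)
    set B := _ `&` _; pose b := Num.max p (Num.min x q).
    have mB : measurable B by exact: measurableI.
    have pb : p <= b by rewrite le_max lexx.
    have bq : b <= q by rewrite ge_max (ltW pq) ge_min lexx orbT.
    have pbB : `]p, b[ `<=` B.
      move=> t /=; rewrite !in_itv /= => /andP[pt].
      rewrite lt_max lt_min ltNge (ltW pt) /=.
      by move=> /andP[tx tq]; split; rewrite //= in_itv /= (ltW pt) ltW.
    have Bpb : B `<=` `[p, b].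
      move=> t [] /=; rewrite !in_itv /= => tx /andP[pt tq].
      by rewrite pt le_max le_min (ltW tx) tq orbT.
    have -> : proj_mass K theta `]-oo, x[%classic = proj_mass K theta B.
      congr (fine (hausdorff1 _)); apply/seteqP; split => z [] /= zx Kz; split => //.
        by split => //; rewrite -projK; exists z.
      by case: zx.
    rewrite (@proj_mass_interval K theta p q p b)//.
    rewrite (eq_integral (fun=> (q - p)^-1%:E)); last first.
      by move=> t; rewrite inE => -[_] /=; rewrite in_itv /= /uniform_pdf => ->.
    rewrite integral_cst//.
    have lebB : lebesgue_measure B = (b - p)%:E.
      have itvE (c d : bool) :
          lebesgue_measure [set` Interval (BSide c p) (BSide d b)] = (b - p)%:E.
        rewrite lebesgue_measure_itv /= lte_fin; case: ltP => [//|bp].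
        by rewrite (@le_anti _ _ p b) ?subrr// pb.
      apply/eqP; rewrite eq_le -{1}(itvE true false) -(itvE false true).
      by rewrite !le_measure// inE.
    transitivity ((mass K)%:E * ((q - p)^-1%:E * (b - p)%:E))%E.
      by rewrite -!EFinM [_^-1 * _]mulrC.
    by congr (_ * (_ * _))%E; rewrite -lebB.
  - by move=> n; rewrite m1E ltry.
transitivity (\int[m1]_t (f t)%:E)%E.
  rewrite (@ge0_integral_pushforward _ _ _ _ _ P mP)//.
    exact/measurable_EFinP.
  by move=> t _; rewrite lee_fin.
transitivity (\int[m2]_t (f t)%:E)%E.
  by apply: eq_measure_integral => A mA _; exact: m12.
have mf' : measurable_fun [set: T] (EFin \o f) by exact/measurable_EFinP.
have f0' (t : T) : setT t -> (0 <= (EFin \o f) t)%E by rewrite lee_fin.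
have := ge0_integral_mscale (uniform_prob pq) measurableT
  (NngNum (fine_ge0 (hausdorff1_ge0 K))) mf' f0'.
rewrite integral_uniform//.
by rewrite muleA -EFinM.
Qed.

Lemma hausdorff1_restr0 K (A : set (R * R)) : (forall z, K z -> ~ A z) ->
  hausdorff1_restr K A = 0%E.
Proof.
move=> KA; rewrite /hausdorff1_restr (_ : _ `&` _ = set0) ?hausdorff1_set0//.
by apply/seteqP; split => // z [Az /KA].
Qed.

(** For [p < q] the law is uniform. For [p = q] the projection is constant on [K], and the
    right-hand side reduces to [mass K * (p + s) ^+ 2]. *)
Lemma second_moment K theta p q s : self_similar K ->
  (hausdorff1 K < +oo)%E -> p <= q -> line_proj theta @` K = `[p, q]%classic ->
  (\int[hausdorff1_restr K]_z ((line_proj theta z + s) ^+ 2)%:E =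
   (mass K * (((p + s) ^+ 2 + (p + s) * (q + s) + (q + s) ^+ 2) / 3))%:E)%E.
Proof.
move=> ssK HKoo; rewrite le_eqVlt => /orP[/eqP <-{q}|pq] projK; last first.
  rewrite (integral_line_proj (f := fun t => (t + s) ^+ 2) ssK HKoo pq projK).
  - rewrite integral_sqr_itv// -EFinM; congr EFin.
    by field; rewrite subr_eq0 gt_eqF.
  - by apply: measurable_funX; apply: measurable_funD.
  - by move=> t; exact: sqr_ge0.
have mP := measurable_line_proj theta.
pose N := ~` (line_proj theta @^-1` [set p]).
have mN : measurable N.
  by apply: measurableC; rewrite -[_ @^-1` _]setTI; exact: mP.
have KN z : K z -> ~ N z.
  move=> Kz; apply; rewrite /=.
  have : (line_proj theta @` K) (line_proj theta z) by exists z.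
  by rewrite projK /= in_itv/= => /le_anti.
have KND : hausdorff1_restr K (setT `\` N) = (mass K)%:E.
  rewrite -massE//; congr hausdorff1.
  by apply/seteqP; split => [z []//|z Kz]; split => //; split => //; exact: KN.
rewrite (@ge0_negligible_integral _ _ _ _ _ N)//; first last.
- exact: hausdorff1_restr0.
- by move=> z _; rewrite lee_fin sqr_ge0.
- apply/measurable_EFinP; apply: measurable_funX; exact: measurable_funD.
rewrite (eq_integral (cst ((p + s) ^+ 2)%:E)); last first.
  by move=> z; rewrite inE => -[_] /contrapT /= ->.
rewrite integral_cst; last exact: measurableD.
transitivity (((p + s) ^+ 2)%:E * (mass K)%:E)%E; first by congr (_ * _)%E.
by rewrite -EFinM mulrC; congr EFin; field.
Qed.

(** The points where the absolute value of [f] exceeds [M] lie off [K], hence form a null set for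
    the restricted measure. *)
Lemma bounded_integrable K (f : R * R -> R) (M : R) : (hausdorff1 K < +oo)%E ->
  measurable_fun setT f -> (forall z, K z -> `|f z| <= M) ->
  (hausdorff1_restr K).-integrable setT (EFin \o f).
Proof.
move=> HKoo mf fM.
pose N := [set z | M < `|f z|].
have mN : measurable N.
  rewrite (_ : N = (Num.norm \o f) @^-1` `]M, +oo[); last first.
    by apply/seteqP; split => z /=; rewrite in_itv/= andbT.
  rewrite -[_ @^-1` _]setTI.
  have mnf := measurableT_comp (@normr_measurable R setT) mf.
  by apply: mnf => //; exact: measurable_itv.
have N0 : hausdorff1_restr K N = 0%E.
  by apply: hausdorff1_restr0 => z /fM /=; rewrite leNgt => /negP.
apply/(negligible_integrable mN) => //; first exact/measurable_EFinP.
apply: measurable_bounded_integrable.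
- exact: measurableD.
- by apply: le_lt_trans HKoo; apply: le_hausdorff1 => z [].
- exact: measurable_funTS.
- exists M; split; first exact: num_real.
  by move=> x Mx z [_ /negP] /=; rewrite -leNgt => /le_trans; apply; exact: ltW.
Qed.

End second_moment.

(** * Moments as functions of the direction, and linear algebra *)

Section moments.
Context (R : realType).
Implicit Types (K : set (R * R)) (theta : R).

(** Expand the square and integrate term by term: [A], [B], [C] are the second moments and [M1],
    [M2] the first ones, all finite as [K] is bounded. *)
Lemma moments_polynomial K : self_similar K -> (hausdorff1 K < +oo)%E ->
  exists A B C M1 M2 : R,
    (\int[hausdorff1_restr K]_z (z.1 * z.2)%:E = B%:E)%E /\
    forall theta s,
      (\int[hausdorff1_restr K]_z ((line_proj theta z + s) ^+ 2)%:E =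
       (cos theta ^+ 2 * A + 2 * cos theta * sin theta * B + sin theta ^+ 2 * C
        + 2 * s * (cos theta * M1 + sin theta * M2) + s ^+ 2 * mass K)%:E)%E.
Proof.
move=> ssK HKoo.
have [Kn0 Kc] : K !=set0 /\ compact K by case: ssK => m [S []].
have [M KM] : exists M, forall z, K z -> `|z.1| <= M /\ `|z.2| <= M.
  have [D [_ KD]] := compact_eucl_dist Kc; have [z0 Kz0] := Kn0.
  exists (D + (`|z0.1| + `|z0.2|)) => z Kz.
  have := le_trans (eucl_dist_fst z z0) (KD _ _ Kz Kz0).
  have := le_trans (eucl_dist_snd z z0) (KD _ _ Kz Kz0).
  have := lerB_dist z.1 z0.1; have := lerB_dist z.2 z0.2.
  have := normr_ge0 z0.1; have := normr_ge0 z0.2.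
  by move: `|z0.1| `|z0.2| => a b *; split; lra.
pose mu := hausdorff1_restr K.
have int2 (f g : R * R -> R) : measurable_fun setT f -> measurable_fun setT g ->
    (forall z, K z -> `|f z| <= M /\ `|g z| <= M) ->
    mu.-integrable setT (EFin \o (fun z => f z * g z)).
  move=> mf mg fgM; apply: (bounded_integrable (M := M * M) HKoo).
    exact: measurable_funM.
  by move=> z Kz; rewrite normrM; have [? ?] := fgM z Kz; exact: ler_pM.
have i11 : mu.-integrable setT (EFin \o (fun z => z.1 * z.1)).
  by apply: int2 => // z /KM[].
have i12 : mu.-integrable setT (EFin \o (fun z => z.1 * z.2)).
  by apply: int2 => // z /KM[].
have i22 : mu.-integrable setT (EFin \o (fun z => z.2 * z.2)).
  by apply: int2 => // z /KM[].
have i1 : mu.-integrable setT (EFin \o fst).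
  by apply: (bounded_integrable (M := M) HKoo) => [|z /KM[]].
have i2 : mu.-integrable setT (EFin \o snd).
  by apply: (bounded_integrable (M := M) HKoo) => [|z /KM[]].
have ic : mu.-integrable setT (EFin \o cst 1).
  by apply: (bounded_integrable (M := 1) HKoo) => // z _; rewrite normr1.
have intZ a f : mu.-integrable setT (EFin \o f) ->
    mu.-integrable setT (EFin \o (fun z => a * f z)).
  by move=> fi; exact: (integrableZl measurableT a fi).
have intD f g : mu.-integrable setT (EFin \o f) ->
    mu.-integrable setT (EFin \o g) ->
    mu.-integrable setT (EFin \o (fun z => f z + g z)).
  by move=> fi gi; exact: (integrableD measurableT fi gi).
pose E f := Rintegral mu setT f.
have EE f : mu.-integrable setT (EFin \o f) ->
    (\int[mu]_z (f z)%:E = (E f)%:E)%E.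
  by move=> fi; rewrite fineK//; exact: (integrable_fin_num measurableT fi).
have EZ a f : mu.-integrable setT (EFin \o f) -> E (fun z => a * f z) = a * E f.
  by move=> fi; exact: RintegralZl.
have ED f g : mu.-integrable setT (EFin \o f) ->
    mu.-integrable setT (EFin \o g) -> E (fun z => f z + g z) = E f + E g.
  by move=> fi gi; exact: RintegralD.
have E1 : E (cst 1) = mass K.
  apply: EFin_inj; rewrite -EE// -massE//.
  rewrite [LHS](integral_cst mu measurableT 1%E) mul1e.
  by congr hausdorff1; rewrite setTI.
exists (E (fun z => z.1 * z.1)), (E (fun z => z.1 * z.2)),
  (E (fun z => z.2 * z.2)), (E fst), (E snd); split; first exact: EE.
move=> theta s.
pose a := cos theta; pose b := sin theta.
pose f z := a ^+ 2 * (z.1 * z.1) + (2 * a * b * (z.1 * z.2) +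
  (b ^+ 2 * (z.2 * z.2) + (2 * s * a * z.1 + (2 * s * b * z.2 +
  s ^+ 2 * cst 1 z)))).
transitivity (\int[mu]_z (f z)%:E)%E.
  apply: eq_integral => z _; congr EFin.
  by rewrite /f /line_proj -/a -/b /=; ring.
have j5 := intZ (s ^+ 2) _ ic.
have j4 := intD _ _ (intZ (2 * s * b) _ i2) j5.
have j3 := intD _ _ (intZ (2 * s * a) _ i1) j4.
have j2 := intD _ _ (intZ (b ^+ 2) _ i22) j3.
have j1 := intD _ _ (intZ (2 * a * b) _ i12) j2.
have j0 := intD _ _ (intZ (a ^+ 2) _ i11) j1.
rewrite (EE _ j0) (ED _ _ (intZ (a ^+ 2) _ i11) j1).
rewrite (ED _ _ (intZ (2 * a * b) _ i12) j2) (ED _ _ (intZ (b ^+ 2) _ i22) j3).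
rewrite (ED _ _ (intZ (2 * s * a) _ i1) j4) (ED _ _ (intZ (2 * s * b) _ i2) j5).
rewrite (EZ _ _ i11) (EZ _ _ i12) (EZ _ _ i22) (EZ _ _ i1) (EZ _ _ i2) (EZ _ _ ic).
by rewrite E1; congr EFin; rewrite -/a -/b; ring.
Qed.

(** The expression is the sine of [theta' - theta]. When it vanishes, the point with parameter [x]
    on one line has parameter [x] times the cosine of [theta' - theta] on the other. *)
Lemma origin_line_cross theta theta' : origin_line theta <> origin_line theta' ->
  cos theta * sin theta' - cos theta' * sin theta != 0.
Proof.
have sub t t' : cos t * sin t' - cos t' * sin t = 0 ->
    origin_line t `<=` origin_line t'.
  move=> cross _ [x _ <-]; exists (x * (cos t * cos t' + sin t * sin t')) => //.
  have := cos2Dsin2 t; have := cos2Dsin2 t'; rewrite /line_pt.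
  move: (cos t) (sin t) (cos t') (sin t') cross => a b a' b' cross n' n.
  congr pair.
    transitivity (x * (a * (a' ^+ 2 + b' ^+ 2) - b' * (a * b' - a' * b))).
      by ring.
    by rewrite n' cross mulr0 subr0 mulr1.
  transitivity (x * (b * (a' ^+ 2 + b' ^+ 2) + a' * (a * b' - a' * b))).
    by ring.
  by rewrite n' cross mulr0 addr0 mulr1.
move=> neq; apply/eqP => cross; apply: neq; apply/seteqP; split; apply: sub => //.
by rewrite -opprB cross oppr0.
Qed.

(* The determinant of the rows [(ai^2, ai * bi, bi^2)] is the product of the
   three cross products. *)
Lemma binary_quadratic_form_eq0 (A B C a1 b1 a2 b2 a3 b3 : R) :
  a1 * b2 - a2 * b1 != 0 -> a1 * b3 - a3 * b1 != 0 -> a2 * b3 - a3 * b2 != 0 ->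
  a1 ^+ 2 * A + a1 * b1 * B + b1 ^+ 2 * C = 0 ->
  a2 ^+ 2 * A + a2 * b2 * B + b2 ^+ 2 * C = 0 ->
  a3 ^+ 2 * A + a3 * b3 * B + b3 ^+ 2 * C = 0 ->
  [/\ A = 0, B = 0 & C = 0].
Proof.
move=> n12 n13 n23; set e1 := (X in X = 0); set e2 := (X in _ -> X = 0 -> _).
set e3 := (X in _ -> _ -> X = 0 -> _) => E1 E2 E3.
pose det := (a1 * b2 - a2 * b1) * (a1 * b3 - a3 * b1) * (a2 * b3 - a3 * b2).
have det0 : det != 0 by rewrite !mulf_neq0.
split; apply: (mulfI det0); rewrite mulr0.
- transitivity (e1 * (a2 * b2 * b3 ^+ 2 - b2 ^+ 2 * (a3 * b3))
    - e2 * (a1 * b1 * b3 ^+ 2 - b1 ^+ 2 * (a3 * b3))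
    + e3 * (a1 * b1 * b2 ^+ 2 - b1 ^+ 2 * (a2 * b2))).
    by rewrite /det /e1 /e2 /e3; ring.
  by rewrite E1 E2 E3 !(mul0r, oppr0, addr0).
- transitivity (- e1 * (a2 ^+ 2 * b3 ^+ 2 - b2 ^+ 2 * a3 ^+ 2)
    + e2 * (a1 ^+ 2 * b3 ^+ 2 - b1 ^+ 2 * a3 ^+ 2)
    - e3 * (a1 ^+ 2 * b2 ^+ 2 - b1 ^+ 2 * a2 ^+ 2)).
    by rewrite /det /e1 /e2 /e3; ring.
  by rewrite E1 E2 E3 !(mul0r, oppr0, addr0).
- transitivity (e1 * (a2 ^+ 2 * (a3 * b3) - a2 * b2 * a3 ^+ 2)
    - e2 * (a1 ^+ 2 * (a3 * b3) - a1 * b1 * a3 ^+ 2)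
    + e3 * (a1 ^+ 2 * (a2 * b2) - a1 * b1 * a2 ^+ 2)).
    by rewrite /det /e1 /e2 /e3; ring.
  by rewrite E1 E2 E3 !(mul0r, oppr0, addr0).
Qed.

Lemma compact_interval_image K theta : compact K -> K !=set0 ->
  is_interval (line_proj theta @` K) ->
  exists p q, p <= q /\ line_proj theta @` K = `[p, q]%classic.
Proof.
move=> Kc Kn0 itvP.
(* With [s] equal to 1 and -1, the maximum principle gives both endpoints. *)
have cont (s : R) : continuous (fun z : R * R => s * line_proj theta z).
  move=> z; apply: cvgM; first exact: cvg_cst.
  by apply: cvgD; apply: cvgM; try exact: cvg_cst; [exact: cvg_fst|exact: cvg_snd].
have ext s := compact_EVT_max Kn0 Kc (continuous_subspaceT (@cont s)).
have [u /set_mem Ku umax] := ext (1 : R).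
have [v /set_mem Kv vmin] := ext (-1 : R).
have le_u z : K z -> line_proj theta z <= line_proj theta u.
  by move=> /mem_set /umax; rewrite !mul1r.
have v_le z : K z -> line_proj theta v <= line_proj theta z.
  by move=> /mem_set /vmin; rewrite !mulN1r lerN2.
exists (line_proj theta v), (line_proj theta u); split; first exact: v_le.
apply/seteqP; split => [_ [z Kz <-]|t]; rewrite /= in_itv /=.
  by rewrite v_le// le_u.
by apply: itvP; [exists v|exists u].
Qed.

End moments.

(** * From three directions to all directions *)

Theorem theorem1p10 (R : realType) (K : set (R * R))
    (c theta1 theta2 theta3 : R)
    (K_self_similar : self_similar K)
    (K_one_set : one_set K)
    (line12 : origin_line theta1 <> origin_line theta2)
    (line13 : origin_line theta1 <> origin_line theta3)
    (line23 : origin_line theta2 <> origin_line theta3)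
    (proj1 : line_proj theta1 @` K = centered_interval c)
    (proj2 : line_proj theta2 @` K = centered_interval c)
    (proj3 : line_proj theta3 @` K = centered_interval c) :
  [/\ (\int[hausdorff1_restr K]_z (z.1 * z.2)%:E = 0)%E,
      forall gamma : R,
        (\int[hausdorff1_restr K]_z (`|line_proj gamma z| ^+ 2)%:E =
         hausdorff1 K * (c ^+ 2 / 12)%:E)%E
    & forall theta : R,
        is_interval (line_proj theta @` K) ->
        line_proj theta @` K = centered_interval c].
Proof.
have /andP[HK0 HKoo] := K_one_set.
have [Kn0 Kc] : K !=set0 /\ compact K.
  by case: K_self_similar => m [S []].
have [A [B [C [M1 [M2 [intB mom]]]]]] := moments_polynomial K_self_similar HKoo.
set mu := mass K in mom.
have mu0 : 0 < mu by rewrite -lte_fin -massE.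
have uniform theta p q s : p <= q -> line_proj theta @` K = `[p, q]%classic ->
    cos theta ^+ 2 * A + 2 * cos theta * sin theta * B + sin theta ^+ 2 * C
    + 2 * s * (cos theta * M1 + sin theta * M2) + s ^+ 2 * mu =
    mu * (((p + s) ^+ 2 + (p + s) * (q + s) + (q + s) ^+ 2) / 3).
  move=> pq projK; apply: EFin_inj; rewrite -mom.
  exact: (second_moment s K_self_similar HKoo pq projK).
(* This sign selects the root of [c ^+ 2] at the end. *)
have c0 : 0 <= c.
  have [z Kz] := Kn0; have : (line_proj theta1 @` K) (line_proj theta1 z) by exists z.
  by rewrite proj1 /centered_interval /= in_itv /= => /andP[? ?]; lra.
pose X := mu * (c ^+ 2 / 12).
have centered theta : line_proj theta @` K = centered_interval c ->
    cos theta * M1 + sin theta * M2 = 0 /\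
    cos theta ^+ 2 * (A - X) + cos theta * sin theta * (2 * B)
      + sin theta ^+ 2 * (C - X) = 0.
  have cc : - (c / 2) <= c / 2 by lra.
  (* Comparing the shifts 0 and 1 separates the quadratic part from the linear one. *)
  move=> projK; have E0 := uniform theta _ _ 0 cc projK.
  have E1 := uniform theta _ _ 1 cc projK.
  have {}E0 : cos theta ^+ 2 * A + 2 * cos theta * sin theta * B
      + sin theta ^+ 2 * C = X.
    by move: E0; rewrite !(addr0, mulr0, mul0r, expr0n)/= /X => ->; field.
  split.
    have : 2 * (cos theta * M1 + sin theta * M2) = 0.
      move: E1; rewrite E0 mulr1 expr1n mul1r => /eqP.
      rewrite -subr_eq0 => /eqP E1; rewrite -[RHS]E1 /X.
      by field.
    by move/eqP; rewrite mulf_eq0 pnatr_eq0 /= => /eqP.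
  (* Multiplying [X] by [cos theta ^+ 2 + sin theta ^+ 2] makes the condition homogeneous. *)
  transitivity (cos theta ^+ 2 * A + 2 * cos theta * sin theta * B
      + sin theta ^+ 2 * C - X * (cos theta ^+ 2 + sin theta ^+ 2)); first by ring.
  by rewrite E0 cos2Dsin2 mulr1 subrr.
have [m1 q1] := centered _ proj1; have [m2 q2] := centered _ proj2.
have [_ q3] := centered _ proj3.
have n12 := origin_line_cross line12.
have [AX B0 CX] := binary_quadratic_form_eq0 n12 (origin_line_cross line13)
  (origin_line_cross line23) q1 q2 q3.
have {}AX : A = X by apply/eqP; rewrite -subr_eq0 AX.
have {}CX : C = X by apply/eqP; rewrite -subr_eq0 CX.
have {}B0 : B = 0 by move/eqP: B0; rewrite mulf_eq0 pnatr_eq0 /= => /eqP.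
(* A linear form vanishing in two independent directions is zero, by Cramer's rule. *)
have M10 : M1 = 0.
  apply: (mulfI n12); rewrite mulr0.
  transitivity (sin theta2 * (cos theta1 * M1 + sin theta1 * M2)
    - sin theta1 * (cos theta2 * M1 + sin theta2 * M2)); first by ring.
  by rewrite m1 m2 !mulr0 subrr.
have M20 : M2 = 0.
  apply: (mulfI n12); rewrite mulr0.
  transitivity (cos theta1 * (cos theta2 * M1 + sin theta2 * M2)
    - cos theta2 * (cos theta1 * M1 + sin theta1 * M2)); first by ring.
  by rewrite m1 m2 !mulr0 subrr.
have momE theta s :
    cos theta ^+ 2 * A + 2 * cos theta * sin theta * B + sin theta ^+ 2 * C
    + 2 * s * (cos theta * M1 + sin theta * M2) + s ^+ 2 * mu = X + s ^+ 2 * mu.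
  rewrite AX B0 CX M10 M20 !(mulr0, addr0) -mulrDl.
  by rewrite cos2Dsin2 mul1r.
split; first by rewrite intB B0.
- move=> gamma; rewrite massE// -EFinM -/mu -/X.
  transitivity (\int[hausdorff1_restr K]_z ((line_proj gamma z + 0) ^+ 2)%:E)%E.
    by apply: eq_integral => z _; rewrite addr0 real_normK ?num_real.
  by rewrite mom momE expr0n mul0r addr0.
- move=> theta itv; have [p [q [pq projK]]] := compact_interval_image Kc Kn0 itv.
  have := uniform theta p q 0 pq projK; have := uniform theta p q 1 pq projK.
  rewrite !momE /X expr1n expr0n /= mul1r mul0r !addr0 => E1 E0.
  (* Shift 0 gives the size, and shift 1 then gives the centre, [p + q = 0]; so
     [c ^+ 2 = 4 * q ^+ 2] with [c] and [q] nonnegative. *)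
  have {}E0 : c ^+ 2 = 4 * (p ^+ 2 + p * q + q ^+ 2).
    by apply: (mulfI (lt0r_neq0 mu0)); lra.
  have qp : q = - p.
    by apply: (mulfI (lt0r_neq0 mu0)); move: E1; rewrite E0; lra.
  have cq : c = 2 * q.
    apply/eqP; rewrite -(@eqrXn2 _ 2)//; last by lra.
    by rewrite E0 qp; apply/eqP; ring.
  have qE : q = c / 2 by lra.
  by rewrite projK /centered_interval -qE qp opprK.
Qed.
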